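(* Let $n\ge2$ and let $M^n$ be an $n$-dimensional Riemannian submanifold, tangent to the Reeb field $\xi$, of a Sasakian space form $\widetilde N^{2m+1}(c)$ (constant $\varphi$-sectional curvature $c$, structure $(\varphi,\xi,\eta,\widetilde g)$) endowed with a semi-symmetric non-metric connection $\widetilde\nabla_XY=\mathring{\widetilde\nabla}_XY+\phi(Y)X$ associated with a $1$-form $\phi$. Then for every $x\in M^n$ and every unit vector $X\in T_xM^n$ orthogonal to $\xi$, $$\operatorname{Ric}(X)\ \ge\ (n-1)\frac{c+3}{4}+\frac{c-1}{4}\bigl(3\|TX\|^2-1\bigr)-\lambda+s(X,X)-n\,\phi(H)+\widetilde g\bigl(P^\perp,\sigma(X,X)\bigr)+\mathcal H(H,\sigma),$$ where $TX$ is the tangential part of $\varphi X$ and $$\mathcal H(H,\sigma)=\frac{n-1}{n}\left(2n\|H\|^2-\|\sigma\|^2-(n-2)\|H\|\sqrt{\frac{n\left(\|\sigma\|^2-n\|H\|^2\right)}{n-1}}\right).$$ For $n\ge3$, equality holds at $x$ (for the vector $X$) if and only if both of the following hold: (i) in an orthonormal frame $\{e_1=X,e_2,\dots,e_n\}$ of $T_xM^n$, for each $\alpha\in\{n+1,\dots,2m+1\}$ the matrix $(\sigma^\alpha_{ij})_{1\le i,j\le n}$ equals $\operatorname{diag}(\lambda_\alpha,\mu_\alpha,\dots,\mu_\alpha)$ with $$\lambda_\alpha=H^\alpha-\frac{n-1}{n}\,\varepsilon_\alpha\sqrt{\frac{n\|\sigma^\alpha\|^2-n^2(H^\alpha)^2}{n-1}},\qquad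 \mu_\alpha=H^\alpha+\frac1n\,\varepsilon_\alpha\sqrt{\frac{n\|\sigma^\alpha\|^2-n^2(H^\alpha)^2}{n-1}},$$ where $\varepsilon_\alpha=\operatorname{sgn}(H^\alpha)$ if $H^\alpha\ne0$, and $\varepsilon_\alpha\in\{+1,-1\}$ (either choice) if $H^\alpha=0$; (ii) writing $D_\alpha:=|\lambda_\alpha-\mu_\alpha|=\sqrt{\frac{n(\|\sigma^\alpha\|^2-n(H^\alpha)^2)}{n-1}}$, if $H\neq0$ at $x$ then there exists $\rho\ge0$ such that $D_\alpha=\rho\,|H^\alpha|$ for all $\alpha$.
   Context: Setting and notation. $\mathring{\widetilde\nabla}$ is the Levi-Civita connection of the ambient metric $\widetilde g$ and $\mathring{\widetilde R}$ its curvature. Curvature convention: $R(X,Y)Z=\nabla_X\nabla_YZ-\nabla_Y\nabla_XZ-\nabla_{[X,Y]}Z$, $R(X,Y,Z,W)=g(R(X,Y)Z,W)$. A Sasakian space form $\widetilde N^{2m+1}(c)$ is a Sasakian manifold $(\varphi,\xi,\eta,\widetilde g)$ of constant $\varphi$-sectional curvature $c$, i.e. (standard formula) $$\mathring{\widetilde R}(X,Y)Z=\tfrac{c+3}{4}\{\widetilde g(Y,Z)X-\widetilde g(X,Z)Y\}+\tfrac{c-1}{4}\{\eta(X)\eta(Z)Y-\eta(Y)\eta(Z)X+\widetilde g(X,Z)\eta(Y)\xi-\widetilde g(Y,Z)\eta(X)\xi+\widetilde g(X,\varphi Z)\varphi Y-\widetilde g(Y,\varphi Z)\varphi X+2\widetilde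 g(X,\varphi Y)\varphi Z\}.$$ For $X$ tangent to $M$, write $\varphi X=TX+FX$ with $TX$ tangential and $FX$ normal; $\|TX\|^2=\sum_{k=1}^n\widetilde g(\varphi X,e_k)^2$. For a $1$-form $\phi$ on $\widetilde N$, the (Agashe–Chafle) semi-symmetric non-metric connection is $\widetilde\nabla_XY=\mathring{\widetilde\nabla}_XY+\phi(Y)X$ (the $1$-form $\phi$ is unrelated to the structure tensor $\varphi$). The vector field $P$ is defined by $\widetilde g(P,X)=\phi(X)$; along $M^n$ write $P=P^\top+P^\perp$ (tangential and normal parts). The $(0,2)$-tensor $s$ on $\widetilde N$ is $s(X,Y)=(\mathring{\widetilde\nabla}_X\phi)(Y)-\phi(X)\phi(Y)$. $M^n$ carries the induced metric. The induced connection $\nabla$ and second fundamental form $\sigma$ are defined by $\widetilde\nabla_XY=\nabla_XY+\sigma(X,Y)$ (tangential plus normal part) for $X,Y$ tangent to $M$; $\sigma$ coincides with the usual Levi-Civita second fundamental form. $R$ denotes the curvature tensor of the induced connection $\nabla$ on $M$. Given orthonormal frames $\{e_1,\dots,e_n\}$ of $T_xM$ and $\{e_{n+1},\dots,e_{2m+1}\}$ of the normal space $T^\perp_xM$: $\sigma^\alpha_{ij}=\widetilde g(\sigma(e_i,e_j),e_\alpha)$, $\|\sigma^\alpha\|^2=\sum_{i,j}(\sigma^\alpha_{ij})^2$, $\|\sigma\|^2=\sum_\alpha\|\sigma^\alpha\|^2$, $H=\frac1n\sum_i\sigma(e_i,e_i)$, $H^\alpha=\frac1n\sum_i\sigma^\alpha_{ii}$,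 $\lambda=\sum_{i=1}^n s(e_i,e_i)$ (trace of $s$ over $T_xM$; not to be confused with the eigenvalues $\lambda_\alpha$), and $\phi(H)=\widetilde g(P^\perp,H)$. Convention for the Ricci curvature: for a unit $X=e_1$ completed to an orthonormal basis of $T_xM$, $\operatorname{Ric}(X):=\sum_{j=2}^nR(X,e_j,e_j,X)$. *)

(* Defs.v *)
From HB Require Import structures.
From mathcomp Require Import all_boot all_order all_algebra.
From mathcomp Require Import all_classical all_reals all_analysis.
From mathcomp Require Import ring.

Set Implicit Arguments.
Unset Strict Implicit.
Unset Printing Implicit Defensive.

Import Order.TTheory GRing.Theory Num.Theory.
Import numFieldNormedType.Exports.

Local Open Scope classical_set_scope.
Local Open Scope ring_scope.

(* Tangent vectors are row vectors of components in a chart, and linear maps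
   act on the right of them.  Geometric objects on a manifold are families of
   components indexed by the charts. *)

(* For V finite-dimensional and U open, this is the usual C^k. *)
Fixpoint Ck (R : realType) (V W : normedModType R) (k : nat) (U : set V)
    (f : V -> W) : Prop :=
  match k with
  | 0%N => forall p, U p -> {for p, continuous f}
  | k'.+1 => (forall p, U p -> differentiable f p) /\
             (forall v, Ck k' U (fun p => 'd f p v))
  end.

Definition smooth_on (R : realType) (V W : normedModType R) (U : set V)
  (f : V -> W) : Prop := forall k, Ck k U f.

(* [cmap i] and [cinv i] are total functions; only their values on [cdom i]
   and on its image are meaningful. *)
Record manifold (R : realType) (d : nat) := Manifold {
  carrier :> topologicalType ;
  manifold_hausdorff : hausdorff_space carrier ;
  manifold_second_countable : @second_countable carrier ;
  chart : Type ;
  cdom : chart -> set carrier ;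
  cmap : chart -> carrier -> 'rV[R]_d ;
  cinv : chart -> 'rV[R]_d -> carrier ;
  cdom_open : forall i, open (cdom i) ;
  cdom_cover : forall x, exists i, cdom i x ;
  cimg_open : forall i, open (cmap i @` cdom i) ;
  cmapK : forall i x, cdom i x -> cinv i (cmap i x) = x ;
  cmap_continuous : forall i x, cdom i x -> {for x, continuous (cmap i)} ;
  cinv_continuous : forall i x, cdom i x ->
    {for cmap i x, continuous (cinv i)} ;
  transition_smooth : forall i j,
    smooth_on (cmap i @` (cdom i `&` cdom j)) (cmap j \o cinv i)
}.

Definition cimg (R : realType) (d : nat) (N : manifold R d) (i : chart N) :
  set 'rV[R]_d := cmap i @` cdom i.

Definition overlap (R : realType) (d : nat) (N : manifold R d)
  (i j : chart N) : set 'rV[R]_d := cmap i @` (cdom i `&` cdom j).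

Definition transition (R : realType) (d : nat) (N : manifold R d)
  (i j : chart N) : 'rV[R]_d -> 'rV[R]_d := cmap j \o cinv i.

Definition ev (R : realType) (d : nat) (w : 'cV[R]_d) (v : 'rV[R]_d) : R :=
  (v *m w) 0 0.

Definition ip (R : realType) (d : nat) (G : 'M[R]_d) (v w : 'rV[R]_d) : R :=
  (v *m G *m w^T) 0 0.

Definition sharp (R : realType) (d : nat) (G : 'M[R]_d) (w : 'cV[R]_d) :
  'rV[R]_d := w^T *m invmx G.

Record vfield (R : realType) (d : nat) (N : manifold R d) := VField {
  vfield_comp :> chart N -> 'rV[R]_d -> 'rV[R]_d ;
  vfield_smooth : forall i, smooth_on (cimg i) (vfield_comp i) ;
  vfield_transf : forall i j p, overlap i j p ->
    vfield_comp j (transition i j p) =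
    'd (transition i j) p (vfield_comp i p)
}.

Record oneform (R : realType) (d : nat) (N : manifold R d) := OneForm {
  oneform_comp :> chart N -> 'rV[R]_d -> 'cV[R]_d ;
  oneform_smooth : forall i, smooth_on (cimg i) (oneform_comp i) ;
  oneform_transf : forall i j p, overlap i j p -> forall v,
    ev (oneform_comp j (transition i j p)) ('d (transition i j) p v) =
    ev (oneform_comp i p) v
}.

Record endofield (R : realType) (d : nat) (N : manifold R d) := EndoField {
  endofield_comp :> chart N -> 'rV[R]_d -> 'M[R]_d ;
  endofield_smooth : forall i, smooth_on (cimg i) (endofield_comp i) ;
  endofield_transf : forall i j p, overlap i j p -> forall v,
    'd (transition i j) p v *m endofield_comp j (transition i j p) =
    'd (transition i j) p (v *m endofield_comp i p)
}.

Record metric (R : realType) (d : nat) (N : manifold R d) := Metric {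
  metric_comp :> chart N -> 'rV[R]_d -> 'M[R]_d ;
  metric_smooth : forall i, smooth_on (cimg i) (metric_comp i) ;
  metric_transf : forall i j p, overlap i j p -> forall v w,
    ip (metric_comp j (transition i j p))
      ('d (transition i j) p v) ('d (transition i j) p w) =
    ip (metric_comp i p) v w ;
  metric_sym : forall i p, cimg i p -> forall v w,
    ip (metric_comp i p) v w = ip (metric_comp i p) w v ;
  metric_pos : forall i p, cimg i p -> forall v, v != 0 ->
    0 < ip (metric_comp i p) v v
}.

(* Tensorial expressions in vectors v, w, z at p are evaluated on the fields
   [cst v], [cst w], [cst z], which extend them with constant coefficients. *)

Section ChartOperators.
Variables (R : realType) (d : nat).
Implicit Types (X Y Z : 'rV[R]_d -> 'rV[R]_d) (p v w z : 'rV[R]_d).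

Definition lie X Y : 'rV[R]_d -> 'rV[R]_d :=
  fun p => 'D_(X p) Y p - 'D_(Y p) X p.

Definition curvature
    (D : ('rV[R]_d -> 'rV[R]_d) -> ('rV[R]_d -> 'rV[R]_d) ->
         'rV[R]_d -> 'rV[R]_d) p v w z : 'rV[R]_d :=
  let X := cst v in let Y := cst w in let Z := cst z in
  D X (D Y Z) p - D Y (D X Z) p - D (lie X Y) Z p.

(* A connection is given by its coefficients Gam = D - (flat connection). *)
Definition cov (Gam : 'rV[R]_d -> 'rV[R]_d -> 'rV[R]_d -> 'rV[R]_d) X Y :
  'rV[R]_d -> 'rV[R]_d := fun p => 'D_(X p) Y p + Gam p (X p) (Y p).

(* The Koszul formula on constant-coefficient fields. *)
Definition christoffel (G : 'rV[R]_d -> 'M[R]_d) p v w : 'rV[R]_d :=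
  let first_kind z : R := 2^-1 *
    ('D_v (fun q => ip (G q) w z) p + 'D_w (fun q => ip (G q) v z) p
     - 'D_z (fun q => ip (G q) v w) p) in
  (\row_k first_kind (delta_mx 0 k)) *m invmx (G p).

Definition levi_civita (G : 'rV[R]_d -> 'M[R]_d) := cov (christoffel G).

(* The connection D_X Y + phi(Y) X, for D the Levi-Civita connection. *)
Definition ssnm_coef (G : 'rV[R]_d -> 'M[R]_d) (phi : 'rV[R]_d -> 'cV[R]_d)
  p v w : 'rV[R]_d := christoffel G p v w + ev (phi p) w *: v.

Definition s_tensor (G : 'rV[R]_d -> 'M[R]_d) (phi : 'rV[R]_d -> 'cV[R]_d)
    p v w : R :=
  'D_v (fun q => ev (phi q) w) p
  - ev (phi p) (levi_civita G (cst v) (cst w) p)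
  - ev (phi p) v * ev (phi p) w.

(* d eta (X,Y) = (X eta(Y) - Y eta(X) - eta([X,Y])) / 2, with the factor 1/2
   customary in contact metric geometry. *)
Definition ext_deriv (eta : 'rV[R]_d -> 'cV[R]_d) p v w : R :=
  let X := cst v in let Y := cst w in
  2^-1 * ('D_v (fun q => ev (eta q) (Y q)) p
          - 'D_w (fun q => ev (eta q) (X q)) p - ev (eta p) (lie X Y p)).

Definition nijenhuis (vphi : 'rV[R]_d -> 'M[R]_d) p v w : 'rV[R]_d :=
  let X := cst v in let Y := cst w in
  let vX := fun q => X q *m vphi q in let vY := fun q => Y q *m vphi q in
  lie X Y p *m vphi p *m vphi p + lie vX vY p
  - lie vX Y p *m vphi p - lie X vY p *m vphi p.

End ChartOperators.

(* A normal contact metric structure: almost contact metric, d eta = g(., phi .)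
   and [phi, phi] + 2 d eta (x) xi = 0. *)
Definition sasakian (R : realType) (d : nat) (N : manifold R d)
    (vphi : endofield N) (xi : vfield N) (eta : oneform N) (g : metric N) :
    Prop :=
  forall i p, cimg i p ->
    [/\ ev (eta i p) (xi i p) = 1,
        forall v, v *m vphi i p *m vphi i p = - v + ev (eta i p) v *: xi i p,
        forall v w, ip (g i p) (v *m vphi i p) (w *m vphi i p) =
                    ip (g i p) v w - ev (eta i p) v * ev (eta i p) w,
        forall v w, ext_deriv (eta i) p v w = ip (g i p) v (w *m vphi i p)
      & forall v w, nijenhuis (vphi i) p v w
                    + (2 * ext_deriv (eta i) p v w) *: xi i p = 0].

(* Constant phi-sectional curvature c, expressed by the standard form of the
   curvature tensor; see [phi_sectional_curvature]. *)
Definition sasakian_space_form (R : realType) (d : nat) (N : manifold R d)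
    (vphi : endofield N) (xi : vfield N) (eta : oneform N) (g : metric N)
    (c : R) : Prop :=
  sasakian vphi xi eta g /\
  forall i p, cimg i p -> forall X Y Z,
    let G := ip (g i p) in let et := ev (eta i p) in
    let ph v := v *m vphi i p in
    curvature (levi_civita (g i)) p X Y Z =
    ((c + 3) / 4) *: (G Y Z *: X - G X Z *: Y)
    + ((c - 1) / 4) *:
      ((et X * et Z) *: Y - (et Y * et Z) *: X
       + (G X Z * et Y) *: xi i p - (G Y Z * et X) *: xi i p
       + G X (ph Z) *: ph Y - G Y (ph Z) *: ph X
       + (2 * G X (ph Y)) *: ph Z).

Lemma phi_sectional_curvature (R : realType) (d : nat) (N : manifold R d)
    (vphi : endofield N) (xi : vfield N) (eta : oneform N) (g : metric N)
    (c : R) (i : chart N) (p X : 'rV[R]_d) :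
  sasakian_space_form vphi xi eta g c -> cimg i p ->
  ip (g i p) X X = 1 -> ev (eta i p) X = 0 ->
  let Y := X *m vphi i p in
  ip (g i p) (curvature (levi_civita (g i)) p X Y Y) X = c.
Proof.
move=> [hS hR] ip_p X1 eX Y.
have [exi vv compat dE _] := hS i p ip_p.
have evD (v w : 'rV_d) : ev (eta i p) (v + w) = ev (eta i p) v + ev (eta i p) w.
  by rewrite /ev mulmxDl mxE.
have evN (v : 'rV_d) : ev (eta i p) (- v) = - ev (eta i p) v.
  by rewrite /ev mulNmx mxE.
have evZ a (v : 'rV_d) : ev (eta i p) (a *: v) = a * ev (eta i p) v.
  by rewrite /ev -scalemxAl mxE.
have ipD (v w z : 'rV_d) : ip (g i p) (v + w) z = ip (g i p) v z + ip (g i p) w z.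
  by rewrite /ip !mulmxDl mxE.
have ipN (v z : 'rV_d) : ip (g i p) (- v) z = - ip (g i p) v z.
  by rewrite /ip !mulNmx mxE.
have ipZ a (v z : 'rV_d) : ip (g i p) (a *: v) z = a * ip (g i p) v z.
  by rewrite /ip -!scalemxAl mxE.
have ipNr (v z : 'rV_d) : ip (g i p) z (- v) = - ip (g i p) z v.
  by rewrite (metric_sym g ip_p) ipN (metric_sym g ip_p v).
have YY : Y *m vphi i p = - X by rewrite vv eX scale0r addr0.
have eY : ev (eta i p) Y = 0.
  have := vv Y; rewrite YY mulNmx -[X *m _]/Y => /esym/eqP.
  rewrite addrC subr_eq addNr => /eqP/(congr1 (ev (eta i p))).
  by rewrite evZ exi mulr1 => ->; rewrite /ev mul0mx mxE.
have XY : ip (g i p) X Y = 0.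
  rewrite -dE /ext_deriv /lie /= !subrr sub0r.
  by rewrite /ev mul0mx mxE oppr0 mulr0.
have Y1 : ip (g i p) Y Y = 1 by rewrite compat X1 eX mul0r subr0.
have YX : ip (g i p) Y X = 0 by rewrite (metric_sym g ip_p).
rewrite hR //= eX eY YY -[X *m _]/Y !ipNr XY YX X1 Y1.
rewrite !(mulr0, mul0r, scale0r, scaler0, subr0, addr0, add0r, oppr0).
rewrite ?scale1r ?scaleN1r !(ipD, ipZ, ipN) X1 ?XY ?YX.
by field.
Qed.

Section Immersions.
Variables (R : realType) (n d : nat) (M : manifold R n) (N : manifold R d).

Definition locrep (f : M -> N) (a : chart M) (b : chart N) :
  'rV[R]_n -> 'rV[R]_d := cmap b \o f \o cinv a.

Definition locrep_dom (f : M -> N) (a : chart M) (b : chart N) :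
  set 'rV[R]_n := cmap a @` (cdom a `&` f @^-1` cdom b).

Definition immersion (f : M -> N) : Prop :=
  continuous f /\
  forall a b, smooth_on (locrep_dom f a b) (locrep f a b) /\
    forall u, locrep_dom f a b u -> injective ('d (locrep f a b) u).

Definition tangent_to (f : M -> N) (xi : vfield N) : Prop :=
  forall a b u, locrep_dom f a b u ->
    exists v, 'd (locrep f a b) u v = xi b (locrep f a b u).

End Immersions.

(* Local geometry of an immersion F, read in charts, into an ambient space
   with metric G and 1-form phi. *)
Section Submanifold.
Variables (R : realType) (n d : nat).
Variables (G : 'rV[R]_d -> 'M[R]_d) (phi : 'rV[R]_d -> 'cV[R]_d).
Variable (F : 'rV[R]_n -> 'rV[R]_d).
Implicit Types (u v w : 'rV[R]_n) (V : 'rV[R]_d).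

Definition induced_metric u : 'M[R]_n :=
  \matrix_(i, j) ip (G (F u)) ('d F u (delta_mx 0 i)) ('d F u (delta_mx 0 j)).

(* Components, in the chart of the submanifold, of the G-orthogonal projection
   of V onto the image of 'd F u. *)
Definition tan_comp u V : 'rV[R]_n :=
  (\row_j ip (G (F u)) V ('d F u (delta_mx 0 j))) *m invmx (induced_metric u).

Definition tangential u V : 'rV[R]_d := 'd F u (tan_comp u V).
Definition normal u V : 'rV[R]_d := V - tangential u V.

(* The ambient semi-symmetric non-metric connection applied to tangent fields
   X and Y of the submanifold; Y is pushed forward to a field along F. *)
Definition ssnm_along (X Y : 'rV[R]_n -> 'rV[R]_n) : 'rV[R]_n -> 'rV[R]_d :=
  let FY := fun u => 'd F u (Y u) in
  fun u => 'D_(X u) FY u + ssnm_coef G phi (F u) ('d F u (X u)) (FY u).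

Definition induced_conn (X Y : 'rV[R]_n -> 'rV[R]_n) : 'rV[R]_n -> 'rV[R]_n :=
  fun u => tan_comp u (ssnm_along X Y u).

Definition sff u v w : 'rV[R]_d := normal u (ssnm_along (cst v) (cst w) u).

Definition tangent_frame u (e : 'I_n -> 'rV[R]_n) : Prop :=
  forall i j, ip (induced_metric u) (e i) (e j) = (i == j)%:R.

Definition normal_frame u (nu : 'I_(d - n) -> 'rV[R]_d) : Prop :=
  (forall al be, ip (G (F u)) (nu al) (nu be) = (al == be)%:R) /\
  (forall al v, ip (G (F u)) (nu al) ('d F u v) = 0).

(* Ric(X), where X is the first vector of the orthonormal frame e. *)
Definition ricci u (X : 'rV[R]_n) (e : 'I_n -> 'rV[R]_n) : R :=
  \sum_(j < n | (0 < j)%N)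
    ip (induced_metric u) (curvature induced_conn u X (e j) (e j)) X.

Definition mean_curvature u (e : 'I_n -> 'rV[R]_n) : 'rV[R]_d :=
  n%:R^-1 *: \sum_(i < n) sff u (e i) (e i).

Definition sff_comp u (nu : 'I_(d - n) -> 'rV[R]_d) al v w : R :=
  ip (G (F u)) (sff u v w) (nu al).

End Submanifold.

Definition starts_with (R : realType) (n : nat) (X : 'rV[R]_n)
  (e : 'I_n -> 'rV[R]_n) : Prop := forall i : 'I_n, i = 0%N :> nat -> e i = X.

(* The quantity H(H, sigma), as a function of ||H|| and ||sigma||^2. *)
Definition calH (R : realType) (n : nat) (normH sqsigma : R) : R :=
  (n%:R - 1) / n%:R *
  (2 * n%:R * normH ^+ 2 - sqsigma
   - (n%:R - 2) * normH *
     Num.sqrt (n%:R * (sqsigma - n%:R * normH ^+ 2) / (n%:R - 1))).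

(* Main.v *)
Require Import Defs.
From HB Require Import structures.
From mathcomp Require Import all_boot all_order all_algebra.
From mathcomp Require Import all_classical all_reals all_analysis.
From mathcomp Require Import ring lra.

(** The curvature of the induced connection is computed by a Gauss equation,
    and the rest is an inequality about symmetric matrices.

    The connection D_X Y + phi(Y) X changes the ambient curvature R(X,Y)Z by
    s(X,Z) Y - s(Y,Z) X ([ssnm_curvature]).  Splitting the ambient derivative of
    tangent fields into tangential and normal parts, as in the classical Gauss
    equation, gives the quadratic terms in sigma and, because the derivative of
    a normal field N in the direction X has the additional tangential term
    phi(N) X, a correction by phi(sigma) ([weingarten], [gauss_equation]).
    Summing over an orthonormal frame e_1 = X, e_2, .. gives
      Ric(X) = (ambient sum) - lambda + s(X,X) - n phi(H) + phi(sigma(X,X))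
               + sum_al sum_(j > 1) (sigma_11 sigma_jj - sigma_1j^2)
    ([ricci_decomposition]).  In a Sasakian space form the ambient sum is
    (n-1)(c+3)/4 + (c-1)/4 (3 |TX|^2 - 1), since xi is a unit tangent vector
    dual to eta and phi is skew ([space_form_ricci]).

    It remains to bound the last sum from below by H(H, sigma).  Fix al and put
    t = sigma_11 - H^al and M = (n-1)/n D_al.  Completing squares shows that the
    sum over j exceeds
      (n-1)/n (2n (H^al)^2 - |sigma^al|^2 - (n-2) |H^al| D_al)
    by exactly
      (n-2) (H^al t + |H^al| M)
      + (n-2)/n sum_(j > 1) sigma_1j^2
      + (n-1)/n (other off-diagonal squares
                 + sum_(j > 1) (sigma_jj - their mean)^2),
    in which every term is nonnegative because |t| <= M ([ricci_bound_le]).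
    For n >= 3 the defect vanishes exactly for the diagonal matrices of (i)
    ([extremal_ricci], [ricci_extremal]).  Adding over al, the Cauchy-Schwarz
    inequality sum |H^al| D_al <= |H| D yields the bound, and its equality case
    is (ii) ([calH_le], [calH_eq]).  Condition (i) may be tested in any frame
    starting with X, since a form that is diagonal with eigenvalues
    la, mu, .., mu is determined by X ([diagonal_form]). *)

Set Implicit Arguments.
Unset Strict Implicit.
Unset Printing Implicit Defensive.

Import Order.TTheory GRing.Theory Num.Theory.
Import numFieldNormedType.Exports.

Local Open Scope classical_set_scope.
Local Open Scope ring_scope.

(** * Calculus of matrix-valued maps *)

Section MatrixCalculus.
Variables (R : realType) (V : normedModType R).
Implicit Types (p v : V).

Lemma differentiable_fsum (W : normedModType R) (I : finType)
    (f : I -> V -> W) p :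
  (forall i, differentiable (f i) p) ->
  differentiable (fun q => \sum_i f i q) p.
Proof.
move=> df; rewrite (_ : (fun q => _) = \sum_i f i).
  by elim/big_ind: _ => // g h; exact: differentiableD.
by apply/funext => q; rewrite fct_sumE.
Qed.

Lemma derive_fsum (W : normedModType R) n (f : 'I_n -> V -> W) p v :
  (forall i, differentiable (f i) p) ->
  'D_v (fun q => \sum_(i < n) f i q) p = \sum_(i < n) 'D_v (f i) p.
Proof.
move=> df; rewrite (_ : (fun q => _) = \sum_(i < n) f i).
  by rewrite derive_sum // => i; apply: diff_derivable.
by apply/funext => q; rewrite fct_sumE.
Qed.

Lemma derive_linear (W : normedModType R) (f : V -> W) p a v v' :
  differentiable f p -> 'D_(a *: v + v') f p = a *: 'D_v f p + 'D_v' f p.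
Proof. by move=> df; rewrite !deriveE // linearP. Qed.

Lemma differentiable_mxP m n (A : V -> 'M[R]_(m, n)) p :
  differentiable A p <-> forall i j, differentiable (fun q => A q i j) p.
Proof.
split=> [dA i j|dA].
  apply: (differentiable_comp (g := fun N : 'M[R]_(m, n) => N i j)) => //.
  exact: differentiable_coord.
rewrite (_ : A = fun q => \sum_(i < m) \sum_(j < n) A q i j *: delta_mx i j).
  do 2!apply: differentiable_fsum => ?; exact: differentiableZl.
by apply/funext => q; exact: matrix_sum_delta.
Qed.

Lemma derive_entry m n (A : V -> 'M[R]_(m, n)) p v i j :
  differentiable A p -> 'D_v (fun q => A q i j) p = ('D_v A p) i j.
Proof. by move=> dA; rewrite derive_mx ?mxE//; apply: diff_derivable. Qed.

Lemma differentiable_mulmx m n k (A : V -> 'M[R]_(m, n))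
    (B : V -> 'M[R]_(n, k)) p :
  differentiable A p -> differentiable B p ->
  differentiable (fun q => A q *m B q) p.
Proof.
move=> /differentiable_mxP dA /differentiable_mxP dB.
apply/differentiable_mxP => i j.
rewrite (_ : (fun q => _) = fun q => \sum_(l < n) A q i l * B q l j).
  by apply: differentiable_fsum => l; apply: differentiableM.
by apply/funext => q; rewrite mxE.
Qed.

Lemma derive_mulmx m n k (A : V -> 'M[R]_(m, n)) (B : V -> 'M[R]_(n, k)) p v :
  differentiable A p -> differentiable B p ->
  'D_v (fun q => A q *m B q) p = 'D_v A p *m B p + A p *m 'D_v B p.
Proof.
move=> dA dB; have dAB := differentiable_mulmx dA dB.
have /differentiable_mxP eA := dA; have /differentiable_mxP eB := dB.
apply/matrixP => i j; rewrite -derive_entry // !mxE -big_split /=.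
rewrite (_ : (fun q => _) = fun q => \sum_(l < n) A q i l * B q l j).
  rewrite derive_fsum => [|l]; last exact: differentiableM.
  apply: eq_bigr => l _; rewrite deriveM; try exact: diff_derivable.
  rewrite !derive_entry //= addrC; congr (_ + _).
  by rewrite mulrC.
by apply/funext => q; rewrite mxE.
Qed.

Lemma differentiable_trmx m n (A : V -> 'M[R]_(m, n)) p :
  differentiable A p -> differentiable (fun q => (A q)^T) p.
Proof.
move=> /differentiable_mxP dA; apply/differentiable_mxP => i j.
by rewrite (_ : (fun q => _) = fun q => A q j i) //; apply/funext => q; rewrite mxE.
Qed.

Lemma derive_trmx m n (A : V -> 'M[R]_(m, n)) p v :
  differentiable A p -> 'D_v (fun q => (A q)^T) p = ('D_v A p)^T.
Proof.
move=> dA; have dAt := differentiable_trmx dA.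
apply/matrixP => i j; rewrite -derive_entry // mxE -derive_entry //.
by rewrite (_ : (fun q => _) = fun q => A q j i) //; apply/funext => q; rewrite mxE.
Qed.

Lemma differentiable_scalemx m n (k : V -> R) (A : V -> 'M[R]_(m, n)) p :
  differentiable k p -> differentiable A p ->
  differentiable (fun q => k q *: A q) p.
Proof.
move=> dk /differentiable_mxP dA; apply/differentiable_mxP => i j.
rewrite (_ : (fun q => _) = (fun q => k q * A q i j)).
  exact: differentiableM.
by apply/funext => q; rewrite mxE.
Qed.

Lemma derive_scalemx m n (k : V -> R) (A : V -> 'M[R]_(m, n)) p v :
  differentiable k p -> differentiable A p ->
  'D_v (fun q => k q *: A q) p = 'D_v k p *: A p + k p *: 'D_v A p.
Proof.
move=> dk dA; have dkA := differentiable_scalemx dk dA.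
have /differentiable_mxP eA := dA.
apply/matrixP => i j; rewrite -derive_entry // !mxE -derive_entry //.
rewrite (_ : (fun q => _) = (fun q => k q * A q i j)).
  rewrite deriveM; try exact: diff_derivable.
  by rewrite /= addrC; congr (_ + _); rewrite mulrC.
by apply/funext => q; rewrite mxE.
Qed.

Lemma differentiable_prod n (f : 'I_n -> V -> R) p :
  (forall i, differentiable (f i) p) ->
  differentiable (fun q => \prod_(i < n) f i q) p.
Proof.
elim: n f => [|n IH] f df.
  rewrite (_ : (fun q => _) = cst 1) //.
  by apply/funext => q; rewrite big_ord0.
rewrite (_ : (fun q => _) =
  (fun q => \prod_(i < n) f (widen_ord (leqnSn n) i) q) * f ord_max).
  by apply: differentiableM => //; apply: IH.
by apply/funext => q; rewrite big_ord_recr.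
Qed.

Lemma differentiable_det n (A : V -> 'M[R]_n) p :
  differentiable A p -> differentiable (fun q => \det (A q)) p.
Proof.
move=> /differentiable_mxP dA; apply: differentiable_fsum => s.
by apply: differentiableM => //; exact: differentiable_prod.
Qed.

Lemma near_eq_differentiable (W : normedModType R) (f g : V -> W) p :
  (\forall q \near p, f q = g q) -> differentiable f p -> differentiable g p.
Proof.
move=> fg df; have fgp : f p = g p by exact: nbhs_singleton fg.
have dh : g \o shift p = cst (g p) + 'd f p +o_ 0 id.
  have fg0 : \forall h \near (0 : V), f (h + p) = g (h + p).
    move: fg; rewrite (near_shift (0 : V) p) /= => fg.
    by apply: filterS fg => h; rewrite subr0.
  apply/eqaddoP => e e0.
  have /diff_locally/eqaddoP/(_ e e0) Df := df.
  apply: filterS2 fg0 Df => h fgh.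
  by rewrite !fctE /= fgh fgp.
have Dg := diff_unique (diff_continuous df) dh.
by apply/diff_locallyP; rewrite Dg; split => //; exact: diff_continuous.
Unshelve. all: by end_near. Qed.

(** Cramer's rule: near p the inverse is a quotient of polynomials in the
    entries of A. *)
Lemma differentiable_invmx n (A : V -> 'M[R]_n) p :
  differentiable A p -> (\forall q \near p, A q \in unitmx) ->
  differentiable (fun q => invmx (A q)) p.
Proof.
move=> dA nA; have uA : A p \in unitmx by exact: nbhs_singleton nA.
have /differentiable_mxP eA := dA.
apply: (@near_eq_differentiable _ (fun q => (\det (A q))^-1 *: \adj (A q))).
  by near=> q; rewrite /invmx (near nA q).
apply: differentiable_scalemx.
  apply: differentiableV; first exact: differentiable_det.
  by move: uA; rewrite unitmxE unitfE.
apply/differentiable_mxP => i j.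
rewrite (_ : (fun q => _) =
  fun q => (-1) ^+ (j + i) * \det (row' j (col' i (A q)))).
  apply: differentiableM => //; apply: differentiable_det.
  apply/differentiable_mxP => k l.
  rewrite (_ : (fun q => _) = fun q => A q (lift j k) (lift i l)) //.
  by apply/funext => q; rewrite !mxE.
by apply/funext => q; rewrite mxE.
Unshelve. all: by end_near. Qed.
End MatrixCalculus.

(** * Symmetry of second derivatives *)

Section SymmetryOfSecondDerivatives.
Variables (R : realType) (V : normedModType R).
Implicit Types (f : V -> R) (p v w : V).

Lemma is_derive_line f v a (s : R) : differentiable f (s *: v + a) ->
  is_derive s 1 (fun t : R => f (t *: v + a)) ('d f (s *: v + a) v).
Proof.
move=> /differentiableP df.
have dl : is_diff s (fun t : R => t *: v + a) (fun t : R => t *: v).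
  rewrite (_ : (fun t : R => t *: v) = (fun t : R => t *: v) + cst 0).
    exact: (@is_diffD _ _ _ (fun t : R => t *: v) (cst a)).
  by apply/funext => t; rewrite fctE addr0.
have dfl := is_diff_comp dl df.
apply: DeriveDef; first by apply: diff_derivable; exact: ex_diff.
by rewrite deriveE ?diff_val /= ?scale1r//; exact: ex_diff.
Qed.

Lemma mvt_line f v a (h : R) : 0 <= h ->
  (forall s : R, 0 <= s <= h -> differentiable f (s *: v + a)) ->
  exists2 s, 0 <= s <= h & f (h *: v + a) - f a = 'd f (s *: v + a) v * h.
Proof.
move=> h0 df.
have [||s sh] := @MVT_segment R (fun t => f (t *: v + a))
    (fun s => 'd f (s *: v + a) v) 0 h h0.
- move=> s; rewrite in_itv /= => /andP[/ltW s0 /ltW sh].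
  by apply: is_derive_line; apply: df; rewrite s0.
- apply: continuous_in_subspaceT => s; rewrite inE /= in_itv /= => sh.
  apply: differentiable_continuous; apply/derivable1_diffP.
  by have [] := is_derive_line (df s sh).
- by rewrite scale0r add0r subr0 => ->; exists s => //; move: sh; rewrite in_itv.
Qed.

(** The mean value theorem is applied along v to the increment of f along w,
    then along w to the derivative along v.  The left-hand side is symmetric in
    v and w, which gives the symmetry of second derivatives in the limit. *)
Lemma second_difference f p v w (h : R) : 0 <= h ->
  (forall s t : R, 0 <= s <= h -> 0 <= t <= h ->
    differentiable f (t *: w + (s *: v + p)) /\
    differentiable (fun q => 'd f q v) (t *: w + (s *: v + p))) ->
  exists s t : R, [/\ 0 <= s <= h, 0 <= t <= h &
    f (h *: w + (h *: v + p)) - f (h *: v + p) - f (h *: w + p) + f p =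
    'd (fun q => 'd f q v) (t *: w + (s *: v + p)) w * h * h].
Proof.
move=> h0 df; have hh : 0 <= h <= h by rewrite h0 lexx.
have h00 : 0 <= (0 : R) <= h by rewrite lexx.
pose f1 q := f (h *: w + q) - f q.
have shiftE q : is_diff q (fun q' => h *: w + q') id.
  rewrite (_ : (id : V -> V) = cst 0 + id).
    exact: (@is_diffD _ _ _ (cst (h *: w)) id).
  by apply/funext => t; rewrite fctE add0r.
have df1 (s : R) : 0 <= s <= h -> is_diff (s *: v + p) f1
    (('d f (h *: w + (s *: v + p)) : V -> R) - ('d f (s *: v + p) : V -> R)).
  move=> sh; have /differentiableP d1 := (df s h sh hh).1.
  have /differentiableP := (df s 0 sh h00).1; rewrite scale0r add0r => d2.
  have d3 := is_diff_comp (shiftE (s *: v + p)) d1.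
  exact: is_diffB.
have [|s sh E] := @mvt_line f1 v p h h0.
  by move=> s sh; have := df1 s sh => /(@ex_diff _ _ _ _ _ _ _).
have [|t th E2] := @mvt_line (fun q => 'd f q v) w (s *: v + p) h h0.
  by move=> t th; exact: (df s t sh th).2.
exists s, t; split => //; rewrite -E2.
have -> : 'd f (h *: w + (s *: v + p)) v - 'd f (s *: v + p) v = 'd f1 (s *: v + p) v.
  by have df1s := df1 s sh; rewrite diff_val.
by rewrite -E /f1; ring.
Qed.

(** If the two mixed derivatives A and B differed at p, they would stay apart
    near p by continuity, whereas the second difference on a small enough
    parallelogram is both a value of A and a value of B. *)
Lemma diff_diffC_scalar (U : set V) f p v w : open U -> U p ->
  (forall q, U q -> differentiable f q) ->
  (forall v q, U q -> differentiable (fun q => 'd f q v) q) ->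
  (forall v w, {for p, continuous (fun q => 'd (fun q => 'd f q v) q w)}) ->
  'd (fun q => 'd f q v) p w = 'd (fun q => 'd f q w) p v.
Proof.
move=> oU Up d1 d2 c2.
have [//|/eqP ne] := pselect ('d (fun q => 'd f q v) p w = 'd (fun q => 'd f q w) p v).
set A := fun q => 'd (fun q => 'd f q v) q w.
set B := fun q => 'd (fun q => 'd f q w) q v.
pose e := `|A p - B p| / 2.
have e0 : 0 < e by rewrite divr_gt0 // normr_gt0 subr_eq0.
have nU : \forall q \near p, U q by exact: open_nbhs_nbhs.
have nA : \forall q \near p, `|A p - A q| < e.
  by move/cvgrPdist_lt : (c2 v w); apply.
have nB : \forall q \near p, `|B p - B q| < e.
  by move/cvgrPdist_lt : (c2 w v); apply.
have /nbhs_ballP[r /= r0 rP] : nbhs p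
    [set q | U q /\ `|A p - A q| < e /\ `|B p - B q| < e].
  by apply: filterS (filterI nU (filterI nA nB)).
(* h is chosen so that the parallelogram with sides h v and h w fits in the
   ball of radius r. *)
pose K := `|v| + `|w| + 1.
have K0 : 0 < K by rewrite ltr_wpDl // addr_ge0.
pose h := r / 2 / K.
have h0 : 0 < h by rewrite !divr_gt0.
have box (x y : V) (s t : R) : `|x| + `|y| + 1 = K -> 0 <= s <= h -> 0 <= t <= h ->
    ball p r (t *: y + (s *: x + p)).
  move=> xyK /andP[s0 sh] /andP[t0 th].
  rewrite -ball_normE /= addrA opprD addrCA subrr addr0 normrN.
  apply: le_lt_trans (ler_normD _ _) _; rewrite !normrZ !ger0_norm //.
  apply: (@le_lt_trans _ _ (h * K)).
    rewrite -xyK !mulrDr mulr1 addrC -[leLHS]addr0.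
    by apply: lerD (ltW h0); apply: lerD; apply: ler_wpM2r.
  by rewrite divfK ?gt_eqF// ltr_pdivrMr // ltr_pMr // ltr1n.
have Kvw : `|v| + `|w| + 1 = K by [].
have Kwv : `|w| + `|v| + 1 = K by rewrite /K (addrC `|w|).
have [|s [t [sh th E1]]] := @second_difference f p v w h (ltW h0).
  by move=> s t sh th; have [Uq _] := rP _ (box _ _ s t Kvw sh th); split; auto.
have [|s' [t' [sh' th' E2]]] := @second_difference f p w v h (ltW h0).
  by move=> s' t' sh' th'; have [Uq _] := rP _ (box _ _ s' t' Kwv sh' th'); split; auto.
have [_ [ltA _]] := rP _ (box _ _ s t Kvw sh th).
have [_ [_ ltB]] := rP _ (box _ _ s' t' Kwv sh' th').
have AB : A (t *: w + (s *: v + p)) = B (t' *: v + (s' *: w + p)).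
  apply: (mulIf (lt0r_neq0 h0)); apply: (mulIf (lt0r_neq0 h0)).
  rewrite -E1 -E2 (_ : h *: w + (h *: v + p) = h *: v + (h *: w + p)).
    by ring.
  by rewrite addrCA.
have : `|A p - B p| < e + e.
  rewrite -(subrKA (A (t *: w + (s *: v + p)))) [X in _ + (X - _)]AB.
  apply: le_lt_trans (ler_normD _ _) _; apply: ltrD => //.
  by rewrite distrC.
by rewrite -mulr2n -mulr_natr divfK ?ltxx// pnatr_eq0.
Qed.

Lemma smooth_differentiable (W : normedModType R) (U : set V) (f : V -> W) q :
  smooth_on U f -> U q -> differentiable f q.
Proof. by move=> /(_ 1%N)[+ _]; apply. Qed.

Lemma smooth_diff (W : normedModType R) (U : set V) (f : V -> W) v :
  smooth_on U f -> smooth_on U (fun q => 'd f q v).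
Proof. by move=> sf k; have [_ +] := sf k.+1; apply. Qed.

Lemma smooth_continuous (W : normedModType R) (U : set V) (f : V -> W) q :
  smooth_on U f -> U q -> {for q, continuous f}.
Proof. by move=> sf; apply: sf 0%N q. Qed.

Lemma diff_entry m n (A : V -> 'M[R]_(m, n)) p v i j :
  differentiable A p -> 'd (fun q => A q i j) p v = ('d A p v) i j.
Proof.
move=> dA; rewrite -!deriveE ?derive_entry //.
by have /differentiable_mxP := dA; apply.
Qed.

Lemma near_eq_diff (W : normedModType R) (f g : V -> W) p v :
  (\forall q \near p, f q = g q) -> differentiable f p ->
  'd f p v = 'd g p v.
Proof.
move=> fg df; rewrite -!deriveE //; first exact: near_eq_derive.
exact: near_eq_differentiable fg df.
Qed.

Lemma diff_diffC m n (U : set V) (f : V -> 'M[R]_(m, n)) p v w :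
  open U -> U p -> smooth_on U f ->
  'd (fun q => 'd f q v) p w = 'd (fun q => 'd f q w) p v.
Proof.
move=> oU Up sf; apply/matrixP => i j; pose g q := f q i j.
have df q : U q -> differentiable f q by exact: smooth_differentiable.
have d2f x q : U q -> differentiable (fun q => 'd f q x) q.
  exact/smooth_differentiable/smooth_diff.
have nU q : U q -> \forall q' \near q, U q' by move=> ?; exact: open_nbhs_nbhs.
have dg q : U q -> differentiable g q.
  by move=> /df /differentiable_mxP; apply.
have gE x q : U q -> \forall q' \near q, ('d f q' x) i j = 'd g q' x.
  by move=> /nU; apply: filterS => q' Uq'; rewrite diff_entry //; exact: df.
have d2e x q : U q -> differentiable (fun q => ('d f q x) i j) q.
  by move=> /(d2f x) /differentiable_mxP; apply.
have d2g x q : U q -> differentiable (fun q => 'd g q x) q.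
  by move=> Uq; apply: near_eq_differentiable (gE x q Uq) (d2e x q Uq).
have ggE x y q : U q -> 'd (fun q => 'd g q x) q y = ('d (fun q => 'd f q x) q y) i j.
  move=> Uq; rewrite -diff_entry; last exact: d2f.
  by apply/esym/near_eq_diff; [exact: gE|exact: d2e].
rewrite -(ggE v w) // -(ggE w v) //.
apply: (diff_diffC_scalar _ _ oU Up dg d2g) => x y.
have : {for p, continuous (fun q => 'd (fun q => 'd f q x) q y)}.
  exact: smooth_continuous (smooth_diff y (smooth_diff x sf)) Up.
move=> /continuous_comp /(_ (@coord_continuous _ _ _ i j _)) ce.
rewrite /prop_for /continuous_at ggE //; apply: cvg_trans ce.
by apply: near_eq_cvg; apply: filterS (nU _ Up) => q Uq; rewrite ggE.
Qed.

End SymmetryOfSecondDerivatives.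

(** * Bilinear maps and their derivatives along a map *)

Section BilinearMaps.
Variables (R : realType) (d : nat).
Implicit Types (A B : 'M[R]_d) (v w z : 'rV[R]_d).

Lemma ipDl A v w z : ip A (v + w) z = ip A v z + ip A w z.
Proof. by rewrite /ip !mulmxDl mxE. Qed.

Lemma ipDr A v w z : ip A z (v + w) = ip A z v + ip A z w.
Proof. by rewrite /ip linearD mulmxDr mxE. Qed.

Lemma ipZl A a v z : ip A (a *: v) z = a * ip A v z.
Proof. by rewrite /ip -!scalemxAl mxE. Qed.

Lemma ipZr A a v z : ip A z (a *: v) = a * ip A z v.
Proof. by rewrite /ip linearZ /= -scalemxAr mxE. Qed.

Lemma ipNl A v z : ip A (- v) z = - ip A v z.
Proof. by rewrite -scaleN1r ipZl mulN1r. Qed.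

Lemma ipNr A v z : ip A z (- v) = - ip A z v.
Proof. by rewrite -scaleN1r ipZr mulN1r. Qed.

Lemma ipBl A v w z : ip A (v - w) z = ip A v z - ip A w z.
Proof. by rewrite ipDl ipNl. Qed.

Lemma ipBr A v w z : ip A z (v - w) = ip A z v - ip A z w.
Proof. by rewrite ipDr ipNr. Qed.

Lemma ip0l A z : ip A 0 z = 0.
Proof. by rewrite -(scale0r 0) ipZl mul0r. Qed.

Lemma ip0r A z : ip A z 0 = 0.
Proof. by rewrite -(scale0r 0) ipZr mul0r. Qed.

Lemma ip_suml A (I : finType) (P : pred I) (f : I -> 'rV[R]_d) z :
  ip A (\sum_(i | P i) f i) z = \sum_(i | P i) ip A (f i) z.
Proof.
by elim/big_ind2: _ => [|? ? ? ? <- <-|//]; rewrite ?ip0l ?ipDl.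
Qed.

Lemma ip_sumr A (I : finType) (P : pred I) (f : I -> 'rV[R]_d) z :
  ip A z (\sum_(i | P i) f i) = \sum_(i | P i) ip A z (f i).
Proof.
by elim/big_ind2: _ => [|? ? ? ? <- <-|//]; rewrite ?ip0r ?ipDr.
Qed.

Lemma ipDm A B v w : ip (A + B) v w = ip A v w + ip B v w.
Proof. by rewrite /ip mulmxDr mulmxDl mxE. Qed.

Lemma ipZm a A v w : ip (a *: A) v w = a * ip A v w.
Proof. by rewrite /ip -scalemxAr -scalemxAl mxE. Qed.

Lemma evD (u : 'cV[R]_d) v w : ev u (v + w) = ev u v + ev u w.
Proof. by rewrite /ev mulmxDl mxE. Qed.

Lemma evZ (u : 'cV[R]_d) a v : ev u (a *: v) = a * ev u v.
Proof. by rewrite /ev -scalemxAl mxE. Qed.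

Lemma ip_nondeg A v w : A \in unitmx ->
  (forall z, ip A v z = ip A w z) -> v = w.
Proof.
move=> uA vw; apply: (can_inj (mulmxK uA)); apply/rowP => k.
have := vw (delta_mx 0 k); rewrite /ip trmx_delta.
by rewrite -!colE !mxE.
Qed.

Lemma posdef_unitmx A : (forall v, v != 0 -> 0 < ip A v v) -> A \in unitmx.
Proof.
move=> Apos; rewrite -row_free_unit -kermx_eq0; apply/eqP.
apply/eqP/rowV0P => v /sub_kermxP vA; apply/eqP/negP => /negP v0.
by have := Apos v v0; rewrite /ip vA mul0mx mxE ltxx.
Qed.

Definition bilin (W : lmodType R) (q : 'rV[R]_d -> 'rV[R]_d -> W) :=
  (forall w, linear (q^~ w)) /\ (forall v, linear (q v)).

Lemma linear_sum_scale (W : lmodType R) (f : 'rV[R]_d -> W) (I : finType)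
    (a : I -> R) (b : I -> 'rV[R]_d) : linear f ->
  f (\sum_i a i *: b i) = \sum_i a i *: f (b i).
Proof.
move=> lf; have f0 : f 0 = 0.
  by have := lf (-1) 0 0; rewrite scaler0 addr0 scaleN1r addNr.
have fZ x w : f (x *: w) = x *: f w by have := lf x w 0; rewrite f0 !addr0.
have fD w w' : f (w + w') = f w + f w' by have := lf 1 w w'; rewrite !scale1r.
by rewrite (big_morph f fD f0); apply: eq_bigr => k _; rewrite fZ.
Qed.

Lemma linear_row_sum (W : lmodType R) (f : 'rV[R]_d -> W) v : linear f ->
  f v = \sum_i v 0 i *: f (delta_mx 0 i).
Proof. by move=> lf; rewrite [in LHS](row_sum_delta v) linear_sum_scale. Qed.

(** Metric duality: the row of the values l(e_k), times A^-1, is the vector that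
    represents the linear form l. *)
Lemma ip_row_invmx A (l : 'rV[R]_d -> R^o) z : A \in unitmx -> linear l ->
  ip A ((\row_k l (delta_mx 0 k)) *m invmx A) z = l z.
Proof.
move=> uA /linear_row_sum ->; rewrite /ip mulmxKV // mxE.
by apply: eq_bigr => k _; rewrite !mxE mulrC.
Qed.

Lemma bilin_expand (W : lmodType R) (B : 'rV[R]_d -> 'rV[R]_d -> W) v w :
  bilin B ->
  B v w = \sum_i \sum_j (v 0 i * w 0 j) *: B (delta_mx 0 i) (delta_mx 0 j).
Proof.
move=> [Bl Br]; rewrite (linear_row_sum v (Bl w)); apply: eq_bigr => i _.
rewrite (linear_row_sum w (Br _)) scaler_sumr; apply: eq_bigr => j _.
by rewrite scalerA.
Qed.

End BilinearMaps.

Section BilinearCalculus.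
Variables (R : realType) (V : normedModType R) (d : nat).

Lemma differentiable_ip (A : V -> 'M[R]_d) (v w : V -> 'rV[R]_d) p :
  differentiable A p -> differentiable v p -> differentiable w p ->
  differentiable (fun q => ip (A q) (v q) (w q)) p.
Proof.
move=> dA dv dw.
have dvAw := differentiable_mulmx (differentiable_mulmx dv dA)
  (differentiable_trmx dw).
by apply: (differentiable_mxP _ _).1 dvAw 0 0.
Qed.

Lemma derive_ip (A : V -> 'M[R]_d) (v w : V -> 'rV[R]_d) p x :
  differentiable A p -> differentiable v p -> differentiable w p ->
  'D_x (fun q => ip (A q) (v q) (w q)) p =
  ip ('D_x A p) (v p) (w p) + ip (A p) ('D_x v p) (w p)
  + ip (A p) (v p) ('D_x w p).
Proof.
move=> dA dv dw; have dvA := differentiable_mulmx dv dA.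
have dwT := differentiable_trmx dw.
rewrite /ip derive_entry; last exact: differentiable_mulmx.
by rewrite !derive_mulmx // derive_trmx // mulmxDl [LHS]mxE [X in X + _ = _]mxE
  [X in X + _ = _]addrC.
Qed.

Lemma differentiable_ev (u : V -> 'cV[R]_d) (v : V -> 'rV[R]_d) p :
  differentiable u p -> differentiable v p ->
  differentiable (fun q => ev (u q) (v q)) p.
Proof.
move=> du dv; have dvu := differentiable_mulmx dv du.
by apply: (differentiable_mxP _ _).1 dvu 0 0.
Qed.

Section Along.
Variables (Gam : 'rV[R]_d -> 'rV[R]_d -> 'rV[R]_d -> 'rV[R]_d).
Variables (U : set 'rV[R]_d) (c A B : V -> 'rV[R]_d) (u : V).
Hypotheses (oU : open U) (Uc : U (c u)).
Hypothesis Gam_bilin : forall p : 'rV[R]_d, U p -> bilin (Gam p).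
Hypothesis dGam : forall a b, differentiable (fun p : 'rV[R]_d => Gam p a b) (c u).
Hypotheses (dc : differentiable c u) (dA : differentiable A u)
  (dB : differentiable B u).

Let near_c : \forall q \near u, U (c q).
Proof.
apply: (differentiable_continuous dc); exact: open_nbhs_nbhs.
Qed.

Let gam i j := fun p : 'rV[R]_d => Gam p (delta_mx 0 i) (delta_mx 0 j).
Let coefs := fun i j q => (A q 0 i * B q 0 j) *: gam i j (c q).

Let dgam i j : differentiable (fun q => gam i j (c q)) u.
Proof. by apply: differentiable_comp => //; exact: dGam. Qed.

Let dcoef i j : differentiable (fun q => A q 0 i * B q 0 j) u.
Proof.
have /differentiable_mxP eA := dA; have /differentiable_mxP eB := dB.
exact: differentiableM.
Qed.

Let coefsE : \forall q \near u,
  \sum_i \sum_j coefs i j q = Gam (c q) (A q) (B q).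
Proof.
by apply: filterS near_c => q Uq; rewrite [RHS]bilin_expand //; exact: Gam_bilin.
Qed.

Let dcoefs : differentiable (fun q => \sum_i \sum_j coefs i j q) u.
Proof.
by do 2!apply: differentiable_fsum => ?; exact: differentiable_scalemx.
Qed.

Lemma differentiable_along :
  differentiable (fun q => Gam (c q) (A q) (B q)) u.
Proof. exact: near_eq_differentiable coefsE dcoefs. Qed.

Let diff_Gam a b y : 'd (fun p : 'rV[R]_d => Gam p a b) (c u) y =
  \sum_i \sum_j (a 0 i * b 0 j) *: 'd (gam i j) (c u) y.
Proof.
pose h := fun p : 'rV[R]_d => \sum_i \sum_j (a 0 i * b 0 j) *: gam i j p.
have dab i j :
    differentiable (fun p : 'rV[R]_d => (a 0 i * b 0 j) *: gam i j p) (c u).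
  by apply: differentiableZ; exact: dGam.
have dh : differentiable h (c u) by do 2!apply: differentiable_fsum => ?.
have hE : \forall p \near (c u : 'rV[R]_d), h p = Gam p a b.
  have : \forall p \near (c u : 'rV[R]_d), U p by exact: open_nbhs_nbhs.
  by apply: filterS => q Uq; rewrite [RHS]bilin_expand //; exact: Gam_bilin.
apply: (etrans (esym (near_eq_diff y hE dh))).
apply: (etrans (esym (deriveE y dh))).
rewrite derive_fsum => [|i]; last exact: differentiable_fsum.
apply: eq_bigr => i _; rewrite derive_fsum //; apply: eq_bigr => j _.
have dg : differentiable (gam i j) (c u) by exact: dGam.
have := deriveZ (a 0 i * b 0 j) (diff_derivable dg : derivable (gam i j) (c u) y).
by rewrite (deriveE y dg).
Qed.

(** The chain and product rules for connection coefficients evaluated along c.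
    Expanding on the basis reduces them to products of scalar functions, so that
    differentiability of Gam in its base point alone is enough. *)
Lemma derive_along x :
  'D_x (fun q => Gam (c q) (A q) (B q)) u =
  'd (fun p : 'rV[R]_d => Gam p (A u) (B u)) (c u) ('d c u x)
  + Gam (c u) ('D_x A u) (B u) + Gam (c u) (A u) ('D_x B u).
Proof.
have /differentiable_mxP eA := dA; have /differentiable_mxP eB := dB.
rewrite -(near_eq_derive x coefsE).
rewrite derive_fsum => [|i]; last first.
  by apply: differentiable_fsum => ?; exact: differentiable_scalemx.
rewrite diff_Gam (bilin_expand ('D_x A u) _ (Gam_bilin Uc)).
rewrite (bilin_expand _ ('D_x B u) (Gam_bilin Uc)) -!big_split /=.
apply: eq_bigr => i _; rewrite derive_fsum => [|j]; last first.
  exact: differentiable_scalemx.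
rewrite -!big_split /=; apply: eq_bigr => j _.
have dg : differentiable (gam i j) (c u) by exact: dGam.
have gE : 'D_x (fun q => gam i j (c q)) u = 'd (gam i j) (c u) ('d c u x).
  apply: (etrans (deriveE x (dgam i j))).
  exact: (congr1 (fun f => f x) (diff_comp dc dg)).
have abE : 'D_x (fun q => A q 0 i * B q 0 j) u =
    'D_x A u 0 i * B u 0 j + A u 0 i * 'D_x B u 0 j.
  rewrite -(derive_entry x _ _ dA) -(derive_entry x _ _ dB).
  have := deriveM (diff_derivable (eA 0 i) : derivable _ _ x)
    (diff_derivable (eB 0 j) : derivable _ _ x).
  by move=> /= E; apply: (etrans E); rewrite addrC; congr (_ + _); exact: mulrC.
apply: (etrans (derive_scalemx x (dcoef i j) (dgam i j))).
by rewrite gE abE [LHS]addrC scalerDl addrA {1 3}/gam.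
Qed.

End Along.
End BilinearCalculus.

(** * The Levi-Civita connection and the semi-symmetric connection *)

Section LeviCivita.
Variables (R : realType) (d : nat) (G : 'rV[R]_d -> 'M[R]_d).
Variable U : set 'rV[R]_d.
Hypotheses (oU : open U) (sG : smooth_on U G).
Hypothesis Gsym : forall p : 'rV[R]_d, U p ->
  forall v w, ip (G p) v w = ip (G p) w v.
Hypothesis Gpos : forall p : 'rV[R]_d, U p ->
  forall v, v != 0 -> 0 < ip (G p) v v.
Implicit Types (p v w z : 'rV[R]_d).

Lemma metric_unitmx p : U p -> G p \in unitmx.
Proof. by move=> Up; apply: posdef_unitmx; exact: Gpos. Qed.

Lemma metric_differentiable p : U p -> differentiable G p.
Proof. exact: smooth_differentiable. Qed.

Lemma derive_ip_cst p v w z : U p ->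
  'D_v (fun q => ip (G q) w z) p = ip ('D_v G p) w z.
Proof.
move=> /metric_differentiable dG.
have := derive_ip v dG (differentiable_cst w p) (differentiable_cst z p).
by rewrite !derive_cst ip0l ip0r !addr0.
Qed.

Lemma derive_metric_sym p v w z : U p ->
  ip ('D_v G p) w z = ip ('D_v G p) z w.
Proof.
move=> Up; rewrite -!derive_ip_cst //; apply: near_eq_derive.
have : \forall q \near p, U q by exact: open_nbhs_nbhs.
by apply: filterS => q Uq; exact: Gsym.
Qed.

(** Christoffel symbols of the first kind. *)
Definition first_kind p v w z : R^o := 2^-1 *
  (ip ('D_v G p) w z + ip ('D_w G p) v z - ip ('D_z G p) v w).

Lemma derive_metric_linear p a v v' : U p ->
  'D_(a *: v + v') G p = a *: 'D_v G p + 'D_v' G p.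
Proof. by move=> /metric_differentiable; exact: derive_linear. Qed.

Lemma first_kind_linear p v w : U p -> linear (first_kind p v w).
Proof.
move=> Up a z z'; rewrite /first_kind derive_metric_linear //.
move: ('D_v G p) ('D_w G p) ('D_z G p) ('D_z' G p) => Gv Gw Gz Gz'.
rewrite !(ipDr, ipZr, ipDm, ipZm) /GRing.scale /=; ring.
Qed.

Lemma ip_christoffel p v w z : U p ->
  ip (G p) (christoffel G p v w) z = first_kind p v w z.
Proof.
move=> Up; rewrite -(ip_row_invmx z (metric_unitmx Up) (first_kind_linear v w Up)).
congr (ip _ (_ *m _) _); apply/rowP => k; rewrite !mxE /first_kind.
by rewrite !derive_ip_cst.
Qed.

Lemma christoffel_bilin p : U p -> bilin (christoffel G p).
Proof.
move=> Up; have uG := metric_unitmx Up.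
split=> x a v v'; apply: (ip_nondeg uG) => z.
  rewrite ipDl ipZl !(ip_christoffel _ _ _ Up) /first_kind derive_metric_linear //.
  move: ('D_v G p) ('D_v' G p) ('D_x G p) ('D_z G p) => Gv Gv' Gx Gz.
  rewrite !(ipDr, ipZr, ipDl, ipZl, ipDm, ipZm); ring.
rewrite ipDl ipZl !(ip_christoffel _ _ _ Up) /first_kind derive_metric_linear //.
move: ('D_v G p) ('D_v' G p) ('D_x G p) ('D_z G p) => Gv Gv' Gx Gz.
rewrite !(ipDr, ipZr, ipDl, ipZl, ipDm, ipZm); ring.
Qed.

Lemma christoffel_sym p v w : U p -> christoffel G p v w = christoffel G p w v.
Proof.
move=> Up; apply: (ip_nondeg (metric_unitmx Up)) => z.
rewrite (ip_christoffel v w z Up) (ip_christoffel w v z Up) /first_kind.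
have := derive_metric_sym z v w Up.
by move: ('D_v G p) ('D_w G p) ('D_z G p) => Gv Gw Gz ->; ring.
Qed.

(** Compatibility with the metric: the Koszul combination was chosen so that
    these two symbols add up to the derivative of the metric. *)
Lemma christoffel_metric p v w z : U p ->
  ip ('D_v G p) w z =
  ip (G p) (christoffel G p v w) z + ip (G p) w (christoffel G p v z).
Proof.
move=> Up; rewrite (Gsym Up w).
rewrite (ip_christoffel v w z Up) (ip_christoffel v z w Up) /first_kind.
have := derive_metric_sym v z w Up.
have := derive_metric_sym w v z Up; have := derive_metric_sym z v w Up.
by move: ('D_v G p) ('D_w G p) ('D_z G p) => Gv Gw Gz -> -> ->; field.
Qed.

Lemma christoffel_differentiable p v w : U p ->
  differentiable (fun q => christoffel G q v w) p.
Proof.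
move=> Up; have nU : \forall q \near p, U q by exact: open_nbhs_nbhs.
have dG := metric_differentiable Up.
have d2G x : differentiable (fun q => 'D_x G q) p.
  apply: (@near_eq_differentiable _ _ _ (fun q => 'd G q x)).
    by apply: filterS nU => q Uq; rewrite deriveE //; exact: metric_differentiable.
  exact: smooth_differentiable (smooth_diff x sG) Up.
apply: (@near_eq_differentiable _ _ _ (fun q =>
   (\row_k (first_kind q v w (delta_mx 0 k))) *m invmx (G q))).
  apply: filterS nU => q Uq; congr (_ *m _); apply/rowP => k.
  by rewrite !mxE /first_kind !derive_ip_cst.
apply: differentiable_mulmx; last first.
  apply: differentiable_invmx => //.
  by apply: filterS nU => q; exact: metric_unitmx.
apply/differentiable_mxP => i k.
rewrite (_ : (fun q => _) = fun q => first_kind q v w (delta_mx 0 k)); last first.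
  by apply/funext => q; rewrite mxE.
have dip x y z : differentiable (fun q => ip ('D_x G q) y z) p.
  exact: (differentiable_ip (d2G x) (differentiable_cst y p) (differentiable_cst z p)).
apply: differentiableM => //; apply: differentiableB => //; exact: differentiableD.
Qed.

End LeviCivita.

(** On constant fields the bracket vanishes and covariant derivatives reduce to
    the coefficients: this is the classical coordinate formula. *)
Definition coef_curvature (R : realType) (d : nat)
    (Gam : 'rV[R]_d -> 'rV[R]_d -> 'rV[R]_d -> 'rV[R]_d) (p v w z : 'rV[R]_d) :=
  'D_v (fun q => Gam q w z) p - 'D_w (fun q => Gam q v z) p
  + Gam p v (Gam p w z) - Gam p w (Gam p v z).

Section ConstantFields.
Variables (R : realType) (d : nat).
Implicit Types (p v w z : 'rV[R]_d).

Lemma lie_cst v w : lie (cst v) (cst w) = cst 0.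
Proof. by apply/funext => p; rewrite /lie !derive_cst subrr. Qed.

Lemma curvature_cov (Gam : 'rV[R]_d -> 'rV[R]_d -> 'rV[R]_d -> 'rV[R]_d)
    p v w z :
  bilin (Gam p) -> curvature (cov Gam) p v w z = coef_curvature Gam p v w z.
Proof.
move=> [Bl _]; rewrite /curvature /= lie_cst.
have covE x y : cov Gam (cst x) (cst y) = fun q => Gam q x y.
  by apply/funext => q; rewrite /cov derive_cst add0r.
rewrite !covE /cov /=.
rewrite (linear_row_sum 0 (Bl z)) big1 => [|i _]; last by rewrite mxE scale0r.
by rewrite subr0 /coef_curvature opprD addrACA -!addrA; congr (_ + _).
Qed.

End ConstantFields.

Section SemiSymmetricConnection.
Variables (R : realType) (d : nat) (G : 'rV[R]_d -> 'M[R]_d).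
Variables (phi : 'rV[R]_d -> 'cV[R]_d) (U : set 'rV[R]_d).
Hypotheses (oU : open U) (sG : smooth_on U G) (sphi : smooth_on U phi).
Hypothesis Gsym : forall p : 'rV[R]_d, U p ->
  forall v w, ip (G p) v w = ip (G p) w v.
Hypothesis Gpos : forall p : 'rV[R]_d, U p ->
  forall v, v != 0 -> 0 < ip (G p) v v.
Implicit Types (p v w z : 'rV[R]_d).

Lemma ssnm_bilin p : U p -> bilin (ssnm_coef G phi p).
Proof.
move=> Up; have [Cl Cr] := christoffel_bilin sG Gpos Up.
split=> x a v v'; rewrite /ssnm_coef.
  rewrite (Cl x a v v') !scalerDr !scalerA addrACA.
  by rewrite [_ * a]mulrC.
by rewrite (Cr x a v v') evD evZ scalerDl !scalerDr !scalerA addrACA.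
Qed.

Lemma differentiable_ev_cst p z : U p -> differentiable (fun q => ev (phi q) z) p.
Proof.
move=> Up; have dphi := smooth_differentiable sphi Up.
exact: (differentiable_ev dphi (differentiable_cst z p)).
Qed.

Lemma ssnm_differentiable p v w : U p ->
  differentiable (fun q => ssnm_coef G phi q v w) p.
Proof.
move=> Up; apply: differentiableD; first exact: (christoffel_differentiable oU).
by apply: differentiableZl; exact: differentiable_ev_cst.
Qed.

Lemma derive_ssnm p x v w : U p ->
  'D_x (fun q => ssnm_coef G phi q v w) p =
  'D_x (fun q => christoffel G q v w) p + 'D_x (fun q => ev (phi q) w) p *: v.
Proof.
move=> Up.
have dC := christoffel_differentiable oU sG Gpos v w Up.
have de := differentiable_ev_cst w Up.
have dev : differentiable (fun q => ev (phi q) w *: v) p by exact: differentiableZl.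
have := deriveD (diff_derivable dC : derivable _ _ x)
  (diff_derivable dev : derivable _ _ x).
move=> E; apply: (etrans E); congr (_ + _).
have := derive_scalemx x de (differentiable_cst v p).
by rewrite derive_cst scaler0 addr0.
Qed.

Lemma s_tensorE p v w :
  s_tensor G phi p v w = 'D_v (fun q => ev (phi q) w) p
  - ev (phi p) (christoffel G p v w) - ev (phi p) v * ev (phi p) w.
Proof. by rewrite /s_tensor /levi_civita /cov derive_cst add0r. Qed.

(** Besides the covariant derivatives of phi, the extra term phi(Y) X acts twice,
    which produces the products phi(X) phi(Z) in s; all other terms cancel
    because the Levi-Civita connection is torsion free. *)
Lemma ssnm_curvature p v w z : U p ->
  coef_curvature (ssnm_coef G phi) p v w z =
  curvature (levi_civita G) p v w z
  + s_tensor G phi p v z *: w - s_tensor G phi p w z *: v.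
Proof.
move=> Up; have bC := christoffel_bilin sG Gpos Up.
rewrite (curvature_cov _ _ _ bC) /coef_curvature !derive_ssnm // !s_tensorE.
have [Cl Cr] := christoffel_bilin sG Gpos Up.
have CD x y y' a : christoffel G p x (y + a *: y') =
    christoffel G p x y + a *: christoffel G p x y'.
  by rewrite addrC (Cr x a y' y) addrC.
(* The derivatives are replaced by variables: only their linear occurrence
   matters. *)
move: ('D_v (fun q => christoffel G q w z) p) => DC1.
move: ('D_w (fun q => christoffel G q v z) p) => DC2.
move: ('D_v (fun q => ev (phi q) z) p) => De1.
move: ('D_w (fun q => ev (phi q) z) p) => De2.
move: (christoffel_sym oU sG Gsym Gpos w v Up).
rewrite /ssnm_coef {Cl Cr}; move: (christoffel G p) CD => C CD Cwv.
rewrite !CD !(evD, evZ) Cwv.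
apply/rowP => k; rewrite !mxE; ring.
Qed.

End SemiSymmetricConnection.

(** * The inequality for one symmetric matrix *)

Section QuadraticEstimate.
Variables (R : rcfType) (n : nat) (i0 : 'I_n).
Hypothesis n2 : (2 <= n)%N.
Variable a : 'I_n -> 'I_n -> R.
Hypothesis a_sym : forall i j, a i j = a j i.

Let N : R := n%:R.
Definition trace_mean : R := n%:R^-1 * \sum_i a i i.
Definition sqnorm : R := \sum_i \sum_j a i j ^+ 2.
(** Up to the factor (n-1)/n, the largest deviation from the mean that a diagonal
    entry can have for the given mean and norm. *)
Definition spread : R :=
  Num.sqrt (n%:R * (sqnorm - n%:R * trace_mean ^+ 2) / (n%:R - 1)).

(** The contribution of one normal direction to the Ricci curvature. *)
Definition ricci_form : R := \sum_(j | j != i0) (a i0 i0 * a j j - a i0 j ^+ 2).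
Definition ricci_bound : R := (n%:R - 1) / n%:R *
  (2 * n%:R * trace_mean ^+ 2 - sqnorm
   - (n%:R - 2) * (`|trace_mean| * spread)).

(* t is the deviation of the distinguished entry from the mean, and mu the mean
   of the remaining diagonal entries. *)
Let t : R := a i0 i0 - trace_mean.
Let mu : R := trace_mean - t / (n%:R - 1).
Let row_part : R := \sum_(j | j != i0) a i0 j ^+ 2.
Let off_part : R :=
  \sum_(i | i != i0) \sum_(j | (j != i0) && (j != i)) a i j ^+ 2.
Let diag_part : R := \sum_(j | j != i0) (a j j - mu) ^+ 2.
Let M : R := (n%:R - 1) / n%:R * spread.

Let N2 : 2 <= N. Proof. by rewrite /N ler_nat. Qed.
Let N0 : N != 0. Proof. by rewrite gt_eqF // (lt_le_trans _ N2). Qed.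
Let Nge0 : 0 <= N. Proof. exact: ler0n. Qed.
Let N2_ge0 : 0 <= N - 2. Proof. by rewrite subr_ge0. Qed.
Let N1_gt0 : 0 < N - 1.
Proof. by rewrite subr_gt0 (lt_le_trans _ N2) // ltr1n. Qed.
Let N1_ge0 : 0 <= N - 1. Proof. exact: ltW. Qed.
Let N10 : N - 1 != 0. Proof. by rewrite gt_eqF. Qed.

Let card_rest : \sum_(j | j != i0) (1 : R) = N - 1.
Proof.
have : \sum_(j : 'I_n) (1 : R) = N by rewrite sumr_const card_ord.
by rewrite (bigD1 i0) //= => <-; rewrite addrC addrK.
Qed.

Let trace_rest : \sum_(j | j != i0) a j j = (N - 1) * mu.
Proof.
have : \sum_j a j j = N * trace_mean by rewrite /trace_mean mulVKf.
rewrite (bigD1 i0) //= => E; rewrite -[LHS](addKr (a i0 i0)) E /mu /t -/N; field.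
exact: N10.
Qed.

Let diag_rest : \sum_(j | j != i0) a j j ^+ 2 = diag_part + (N - 1) * mu ^+ 2.
Proof.
have -> : diag_part = \sum_(j | j != i0) a j j ^+ 2
    - 2 * mu * \sum_(j | j != i0) a j j + mu ^+ 2 * \sum_(j | j != i0) 1.
  rewrite !mulr_sumr -sumrB -big_split /=; apply: eq_bigr => j _; ring.
rewrite trace_rest card_rest; ring.
Qed.

Let ricci_formE : ricci_form = (N - 1) * trace_mean ^+ 2
  + (N - 2) * trace_mean * t - t ^+ 2 - row_part.
Proof.
rewrite /ricci_form sumrB -mulr_sumr trace_rest /row_part /mu.
have -> : a i0 i0 = trace_mean + t by rewrite /t addrC subrK.
rewrite -/N; field; exact: N10.
Qed.

Let sqnormE : sqnorm = a i0 i0 ^+ 2 + 2 * row_part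
  + (diag_part + (N - 1) * mu ^+ 2) + off_part.
Proof.
rewrite /sqnorm (bigD1 i0) //= (bigD1 i0) //= -/row_part.
have -> : \sum_(i | i != i0) \sum_j a i j ^+ 2 =
    row_part + (\sum_(j | j != i0) a j j ^+ 2 + off_part).
  rewrite /row_part -!big_split /=; apply: eq_bigr => i ii0.
  rewrite (bigD1 i0) //= (a_sym i i0) (bigD1 i) //=.
rewrite diag_rest; ring.
Qed.

Let excess : N / (N - 1) * t ^+ 2 + 2 * row_part + off_part + diag_part =
  sqnorm - N * trace_mean ^+ 2.
Proof.
rewrite sqnormE /mu; have -> : a i0 i0 = trace_mean + t by rewrite /t addrC subrK.
rewrite -/N; field; exact: N10.
Qed.

Let row_ge0 : 0 <= row_part. Proof. by apply: sumr_ge0 => j _; exact: sqr_ge0. Qed.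
Let off_ge0 : 0 <= off_part.
Proof. by do 2!apply: sumr_ge0 => ? _; exact: sqr_ge0. Qed.
Let diag_ge0 : 0 <= diag_part.
Proof. by apply: sumr_ge0 => j _; exact: sqr_ge0. Qed.

Lemma sqr_spread :
  spread ^+ 2 = n%:R * (sqnorm - n%:R * trace_mean ^+ 2) / (n%:R - 1).
Proof.
rewrite sqr_sqrtr // -/N -excess.
apply: divr_ge0 => //; apply: mulr_ge0 => //.
have h : 0 <= N / (N - 1) * t ^+ 2 by rewrite mulr_ge0 ?sqr_ge0 // divr_ge0.
by rewrite !addr_ge0 // mulr_ge0.
Qed.

Let sqrM : M ^+ 2 =
  t ^+ 2 + (N - 1) / N * (2 * row_part + off_part + diag_part).
Proof.
rewrite /M exprMn sqr_spread -/N -excess; field; by rewrite N0 N10.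
Qed.

Let M_ge0 : 0 <= M.
Proof.
by rewrite /M mulr_ge0 ?sqrtr_ge0 // divr_ge0.
Qed.

Let t_le_M : `|t| <= M.
Proof.
rewrite -(ger0_norm M_ge0) -ler_sqr ?nnegrE // !real_normK ?num_real // sqrM.
rewrite lerDl; apply: mulr_ge0; first by rewrite divr_ge0.
by rewrite !addr_ge0 // mulr_ge0.
Qed.

(* Each of the three summands is nonnegative, the first one because |t| <= M. *)
Let ricci_defect : ricci_form - ricci_bound =
  (N - 2) * (trace_mean * t + `|trace_mean| * M)
  + (N - 2) / N * row_part + (N - 1) / N * (off_part + diag_part).
Proof.
have -> : ricci_bound = (N - 1) * trace_mean ^+ 2 - M ^+ 2
    - (N - 2) * (`|trace_mean| * M).
  have -> : M ^+ 2 = (N - 1) / N * (sqnorm - N * trace_mean ^+ 2).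
    by rewrite /M exprMn sqr_spread -/N; field; rewrite N0 N10.
  by rewrite /ricci_bound /M -/N; field.
rewrite ricci_formE sqrM; field; exact: N0.
Qed.

Let mean_t_ge0 : 0 <= trace_mean * t + `|trace_mean| * M.
Proof.
rewrite -[X in X + _]opprK addrC subr_ge0.
apply: le_trans (ler_norm _) _; rewrite normrN normrM.
exact: ler_wpM2l.
Qed.

Let Nfrac2 : 0 <= (N - 2) / N.
Proof. by rewrite divr_ge0. Qed.
Let Nfrac1 : 0 < (N - 1) / N.
Proof. by rewrite divr_gt0 // lt_def N0. Qed.

Lemma ricci_bound_le : ricci_bound <= ricci_form.
Proof.
rewrite -subr_ge0 ricci_defect; apply: addr_ge0.
  by apply: addr_ge0; apply: mulr_ge0.
by apply: mulr_ge0; [exact: ltW|exact: addr_ge0].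
Qed.

(** The matrices diag(la, mu, .., mu) whose deviation t is extreme and, if the
    mean is nonzero, has the sign opposite to it. *)
Definition extremal (eps : R) :=
  (if trace_mean != 0 then eps = Num.sg trace_mean else eps = 1 \/ eps = -1) /\
  forall i j, a i j = if i != j then 0 else
    if i == i0 then trace_mean - (n%:R - 1) / n%:R * eps * spread
    else trace_mean + n%:R^-1 * eps * spread.

Lemma extremal_ricci eps : extremal eps -> ricci_form = ricci_bound.
Proof.
move=> [epsE aE]; apply/eqP; rewrite -subr_eq0 ricci_defect; apply/eqP.
have tE : t = - eps * M.
  rewrite /t aE eqxx /M -/N /=; ring.
have -> : row_part = 0.
  by rewrite /row_part big1 // => j ji; rewrite aE eq_sym ji expr0n.
have -> : off_part = 0.
  by rewrite /off_part big1 // => i _; rewrite big1 // => j /andP[_ ji];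
    rewrite aE eq_sym ji expr0n.
have -> : diag_part = 0.
  rewrite /diag_part big1 // => j /negPf ji; rewrite aE eqxx ji /mu tE /M -/N /=.
  rewrite (_ : _ - _ = 0) ?expr0n //.
  by field; rewrite N0 N10.
have -> : trace_mean * t + `|trace_mean| * M = 0; last by ring.
rewrite tE; case: eqVneq epsE => [-> _|_ ->]; first by rewrite normr0 !mul0r addr0.
by rewrite normrEsg; ring.
Qed.

(** For n >= 3 all coefficients in the defect are positive, so its vanishing kills
    the off-diagonal entries and makes the last n - 1 diagonal entries equal,
    and forces |t| = M, with t of sign opposite to a nonzero mean. *)
Lemma ricci_extremal : (3 <= n)%N -> ricci_form = ricci_bound ->
  exists eps, extremal eps.
Proof.
move=> n3 /eqP; rewrite -subr_eq0 ricci_defect.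
have N2p : 0 < N - 2 by rewrite subr_gt0 /N ltr_nat.
have Np2 : 0 < (N - 2) / N by rewrite divr_gt0 // lt_def N0.
have p1 : 0 <= (N - 2) * (trace_mean * t + `|trace_mean| * M) by exact: mulr_ge0.
have p2 : 0 <= (N - 2) / N * row_part by exact: mulr_ge0.
have p3 : 0 <= (N - 1) / N * (off_part + diag_part).
  by apply: mulr_ge0; [exact: ltW|exact: addr_ge0].
rewrite (paddr_eq0 (addr_ge0 p1 p2) p3) (paddr_eq0 p1 p2).
rewrite (mulf_eq0 (N - 2)) (mulf_eq0 ((N - 2) / N)) (mulf_eq0 ((N - 1) / N)).
rewrite (gt_eqF N2p) (gt_eqF Np2) (gt_eqF Nfrac1) /=.
rewrite (paddr_eq0 off_ge0 diag_ge0) =>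
  /andP[/andP[/eqP tE /eqP r0] /andP[/eqP o0 /eqP d0]].
have /eqP : M ^+ 2 = t ^+ 2 by rewrite sqrM r0 o0 d0 !(mulr0, addr0).
rewrite eqf_sqr => tM.
have [eps [epsE tme]] : exists eps : R,
    (if trace_mean != 0 then eps = Num.sg trace_mean else eps = 1 \/ eps = -1)
    /\ t = - eps * M.
  case: (eqVneq trace_mean 0) => [H0|H0].
    case/orP: tM => /eqP ->; first by exists (-1); split; [right|ring].
    by exists 1; split; [left|ring].
  exists (Num.sg trace_mean); split=> //.
  have /eqP : trace_mean * (t + Num.sg trace_mean * M) = 0.
    by rewrite -[RHS]tE normrEsg; ring.
  by rewrite mulf_eq0 (negPf H0) /= addr_eq0 mulNr => /eqP.
exists eps; split=> // i j.
have sum0 (P : pred 'I_n) (f : 'I_n -> R) k : (forall i, 0 <= f i) ->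
    \sum_(i | P i) f i = 0 -> P k -> f k = 0.
  move=> f0 /eqP; rewrite psumr_eq0 // => /allP h Pk.
  by have := h k (mem_index_enum k); rewrite /= Pk => /eqP.
have rj k : k != i0 -> a i0 k = 0.
  move=> ki; apply/eqP; rewrite -sqrf_eq0; apply/eqP.
  apply: (sum0 (fun j => j != i0) (fun j => a i0 j ^+ 2)) => // l.
  exact: sqr_ge0.
case: (eqVneq i j) => [<-|ij] /=.
  case: (eqVneq i i0) => [->|ii0].
    rewrite (_ : a i0 i0 = trace_mean + t); last by rewrite /t addrC subrK.
    by rewrite tme /M; ring.
  have /eqP : (a i i - mu) ^+ 2 = 0.
    by apply: (sum0 (fun j => j != i0) (fun j => (a j j - mu) ^+ 2)) => // k; exact: sqr_ge0.
  rewrite sqrf_eq0 subr_eq0 => /eqP ->; rewrite /mu tme /M -/N; field.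
  by rewrite N0 N10.
case: (eqVneq i i0) ij => [->|ii0] ij; first by rewrite rj // eq_sym.
case: (eqVneq j i0) ij => [->|ji0] ij; first by rewrite a_sym rj.
apply/eqP; rewrite -sqrf_eq0; apply/eqP.
have rest0 : \sum_(j | (j != i0) && (j != i)) a i j ^+ 2 = 0.
  apply: (sum0 (fun i => i != i0)
    (fun i => \sum_(j | (j != i0) && (j != i)) a i j ^+ 2)) => // k.
  by apply: sumr_ge0 => l _; exact: sqr_ge0.
apply: (sum0 _ (fun j => a i j ^+ 2) j _ rest0); last by rewrite ji0 eq_sym.
by move=> k; exact: sqr_ge0.
Qed.

End QuadraticEstimate.

(** * The inequality for a family of symmetric matrices *)

Section CauchySchwarz.
Variables (R : rcfType) (I : finType) (x y : I -> R).

Let A := \sum_i x i ^+ 2.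
Let B := \sum_i y i ^+ 2.
Let C := \sum_i x i * y i.

Let sum_sqr_sub c :
  \sum_i (y i - c * x i) ^+ 2 = B - 2 * c * C + c ^+ 2 * A.
Proof.
rewrite /A /B /C !mulr_sumr -sumrB -big_split /=.
by apply: eq_bigr => i _; ring.
Qed.

(* The residual of the orthogonal projection of y on x. *)
Let residual : A != 0 -> \sum_i (y i - C / A * x i) ^+ 2 = B - C ^+ 2 / A.
Proof. by move=> A0; rewrite sum_sqr_sub; field. Qed.

Let A_ge0 : 0 <= A. Proof. by apply: sumr_ge0 => i _; exact: sqr_ge0. Qed.

Let A0_x0 : A = 0 -> forall i, x i = 0.
Proof.
move=> /eqP; rewrite /A psumr_eq0 => [/allP h i|i _]; last exact: sqr_ge0.
by have := h i (mem_index_enum i); rewrite /= sqrf_eq0 => /eqP.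
Qed.

Lemma cauchy_schwarz : C <= Num.sqrt A * Num.sqrt B.
Proof.
have [A0|A0] := eqVneq A 0.
  rewrite {1}/C big1 ?mulr_ge0 ?sqrtr_ge0 // => i _.
  by rewrite A0_x0 // mul0r.
have Apos : 0 < A by rewrite lt_def A0.
have : 0 <= B - C ^+ 2 / A by rewrite -residual //;
  apply: sumr_ge0 => i _; exact: sqr_ge0.
rewrite subr_ge0 ler_pdivrMr // mulrC => CAB.
apply: le_trans (ler_norm C) _.
by rewrite -sqrtrM // -sqrtr_sqr ler_wsqrtr.
Qed.

Lemma cauchy_schwarz_eq : (forall i, 0 <= x i) -> (forall i, 0 <= y i) ->
  C = Num.sqrt A * Num.sqrt B <->
  (Num.sqrt A != 0 -> exists2 rho : R, 0 <= rho & forall i, y i = rho * x i).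
Proof.
move=> x0 y0; split=> [E|prop].
  rewrite sqrtr_eq0 -ltNge => Apos; have A0 : A != 0 by rewrite gt_eqF.
  have C0 : 0 <= C by apply: sumr_ge0 => i _; exact: mulr_ge0.
  exists (C / A); first by rewrite divr_ge0.
  have B0 : 0 <= B by apply: sumr_ge0 => i _; exact: sqr_ge0.
  have /eqP : \sum_i (y i - C / A * x i) ^+ 2 = 0.
    rewrite residual // E exprMn !sqr_sqrtr // mulrAC divff // mul1r subrr //.
  rewrite psumr_eq0 => [/allP h i|i _]; last exact: sqr_ge0.
  by have := h i (mem_index_enum i); rewrite /= sqrf_eq0 subr_eq0 => /eqP.
have [A0|A0] := eqVneq (Num.sqrt A) 0.
  rewrite A0 mul0r; move/eqP: A0; rewrite sqrtr_eq0 => A0.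
  have {}A0 : A = 0 by apply/eqP; rewrite eq_le A0.
  by rewrite /C big1 // => i _; rewrite A0_x0 // mul0r.
have [rho rho0 yE] := prop A0.
have -> : B = rho ^+ 2 * A.
  by rewrite /B /A mulr_sumr; apply: eq_bigr => i _; rewrite yE exprMn.
rewrite sqrtrM ?sqr_ge0 // sqrtr_sqr ger0_norm // mulrCA -expr2 sqr_sqrtr //.
by rewrite /C /A mulr_sumr; apply: eq_bigr => i _; rewrite yE; ring.
Qed.

End CauchySchwarz.

Section TotalEstimate.
Variables (R : realType) (n : nat) (i0 : 'I_n).
Hypothesis n2 : (2 <= n)%N.
Variables (I : finType) (a : I -> 'I_n -> 'I_n -> R).
Hypothesis a_sym : forall al i j, a al i j = a al j i.

Let h := Num.sqrt (\sum_al trace_mean (a al) ^+ 2).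
Let S := \sum_al sqnorm (a al).
Let CS := \sum_al `|trace_mean (a al)| * spread (a al).
Let k : R := (n%:R - 1) / n%:R.

Let k_gt0 : 0 < k.
Proof.
rewrite /k divr_gt0 ?ltr0n ?(leq_trans _ n2) // subr_gt0 ltr1n.
exact: n2.
Qed.

Let sqr_h : h ^+ 2 = \sum_al trace_mean (a al) ^+ 2.
Proof. by rewrite sqr_sqrtr // sumr_ge0 // => al _; exact: sqr_ge0. Qed.

Let calH_E : calH n h S = k * (2 * n%:R * h ^+ 2 - S
  - (n%:R - 2) * (h * Num.sqrt (\sum_al spread (a al) ^+ 2))).
Proof.
have -> : \sum_al spread (a al) ^+ 2 =
    n%:R * (S - n%:R * h ^+ 2) / (n%:R - 1).
  rewrite sqr_h /S mulr_sumr -sumrB mulr_sumr mulr_suml.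
  by apply: eq_bigr => al _; rewrite sqr_spread.
by rewrite /calH /k !mulrA.
Qed.

Let sum_bound : \sum_al ricci_bound (a al) =
  k * (2 * n%:R * h ^+ 2 - S - (n%:R - 2) * CS).
Proof.
rewrite sqr_h /S /CS !mulr_sumr -!sumrB mulr_sumr; apply: eq_bigr => al _.
by rewrite /ricci_bound.
Qed.

Let sum_norm : \sum_al `|trace_mean (a al)| ^+ 2 = \sum_al trace_mean (a al) ^+ 2.
Proof. by apply: eq_bigr => al _; rewrite real_normK ?num_real. Qed.

Let hE : h = Num.sqrt (\sum_al `|trace_mean (a al)| ^+ 2).
Proof. by rewrite sum_norm. Qed.

Let n2_ge0 : 0 <= n%:R - 2 :> R. Proof. by rewrite subr_ge0 ler_nat. Qed.

(* The total defect: one part from each matrix, one from Cauchy-Schwarz. *)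
Let gap : \sum_al ricci_form i0 (a al) - calH n h S =
  \sum_al (ricci_form i0 (a al) - ricci_bound (a al))
  + k * ((n%:R - 2) * (h * Num.sqrt (\sum_al spread (a al) ^+ 2) - CS)).
Proof. by rewrite sumrB sum_bound calH_E; ring. Qed.

Let CS_ge0 : 0 <= h * Num.sqrt (\sum_al spread (a al) ^+ 2) - CS.
Proof. by rewrite subr_ge0 hE; exact: cauchy_schwarz. Qed.

Let forms_ge0 : 0 <= \sum_al (ricci_form i0 (a al) - ricci_bound (a al)).
Proof. by apply: sumr_ge0 => al _; rewrite subr_ge0; exact: ricci_bound_le. Qed.

Lemma calH_le : calH n h S <= \sum_al ricci_form i0 (a al).
Proof.
rewrite -subr_ge0 gap; apply: addr_ge0 => //.
by apply: mulr_ge0; [exact: ltW|exact: mulr_ge0].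
Qed.

Lemma calH_eq : (3 <= n)%N ->
  \sum_al ricci_form i0 (a al) = calH n h S <->
  (forall al, exists eps, extremal i0 (a al) eps) /\
  (h != 0 -> exists2 rho : R, 0 <= rho &
     forall al, spread (a al) = rho * `|trace_mean (a al)|).
Proof.
move=> n3; have n2_gt0 : 0 < n%:R - 2 :> R by rewrite subr_gt0 ltr_nat.
have abs0 al : 0 <= `|trace_mean (a al)| by exact: normr_ge0.
have spread0 al : 0 <= spread (a al) by exact: sqrtr_ge0.
have CSeq := cauchy_schwarz_eq abs0 spread0; rewrite -hE in CSeq.
have -> : \sum_al ricci_form i0 (a al) = calH n h S <->
    \sum_al (ricci_form i0 (a al) - ricci_bound (a al)) = 0 /\
    CS = h * Num.sqrt (\sum_al spread (a al) ^+ 2).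
  split=> [/eqP|[s0 cs]].
    rewrite -subr_eq0 gap paddr_eq0 //; last first.
      by apply: mulr_ge0; [exact: ltW|exact: mulr_ge0].
    rewrite mulf_eq0 (gt_eqF k_gt0) mulf_eq0 (gt_eqF n2_gt0) /= subr_eq0.
    by move=> /andP[/eqP -> /eqP ->].
  by apply/eqP; rewrite -subr_eq0 gap s0 -cs subrr !mulr0 addr0.
split=> [[s0 /CSeq cs]|[ext prop]]; split=> //.
- move=> al; apply: (ricci_extremal n2 (a_sym al)) => //.
  move/eqP: s0; rewrite psumr_eq0 => [/allP s0|be _]; last first.
    by rewrite subr_ge0; exact: ricci_bound_le.
  by have := s0 al (mem_index_enum al); rewrite /= subr_eq0 => /eqP.
- rewrite big1 // => al _; have [eps e] := ext al.
  by rewrite (extremal_ricci n2 (a_sym al) e) subrr.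
- exact/CSeq.
Qed.

End TotalEstimate.

(** * Orthonormal families *)

Section OrthonormalFamilies.
Variables (R : realType) (d : nat) (A : 'M[R]_d).

(** The rows b_i form a matrix B with B A B^T = 1, so they are free; as there are
    at least d of them they span the whole space. *)
Lemma orthonormal_complete k (b : 'I_k -> 'rV[R]_d) W : (d <= k)%N ->
  (forall i j, ip A (b i) (b j) = (i == j)%:R) ->
  (forall i, ip A W (b i) = 0) -> W = 0.
Proof.
move=> dk ob Wb; pose Bm := \matrix_(i < k) b i.
have BE m (X : 'M[R]_(m, d)) i j : (X *m A *m Bm^T) i j = ip A (row i X) (b j).
  rewrite /ip -row_mul !mxE; apply: eq_bigr => l _.
  by rewrite !mxE.
have B1 : Bm *m A *m Bm^T = 1%:M.
  by apply/matrixP => i j; rewrite BE rowK ob mxE.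
have W0 : W *m A *m Bm^T = 0.
  apply/matrixP => i j; rewrite BE (_ : row i W = W) ?Wb ?mxE //.
  by apply/rowP => l; rewrite mxE ord1.
have fB : row_free Bm.
  by apply/row_freeP; exists (A *m Bm^T); rewrite mulmxA.
have /submxP[c cE] : (W <= Bm)%MS.
  apply: submx_full; rewrite /row_full eqn_leq rank_leq_col /=.
  by move: fB; rewrite /row_free => /eqP ->.
have : c = 0 by rewrite -[c]mulmx1 -B1 !mulmxA -cE.
by rewrite cE => ->; rewrite mul0mx.
Qed.

Lemma orthonormal_expand k (b : 'I_k -> 'rV[R]_d) W : (d <= k)%N ->
  (forall i j, ip A (b i) (b j) = (i == j)%:R) ->
  W = \sum_i ip A W (b i) *: b i.
Proof.
move=> dk ob; apply/eqP; rewrite -subr_eq0; apply/eqP.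
apply: (orthonormal_complete dk ob) => j.
rewrite ipBl ip_suml (bigD1 j) //= ipZl ob eqxx mulr1 big1 ?addr0 ?subrr // => i ij.
by rewrite ipZl ob (negPf ij) mulr0.
Qed.

Hypothesis A_sym : forall v w, ip A v w = ip A w v.

Lemma parseval k (b : 'I_k -> 'rV[R]_d) W W' : (d <= k)%N ->
  (forall i j, ip A (b i) (b j) = (i == j)%:R) ->
  ip A W W' = \sum_i ip A W (b i) * ip A W' (b i).
Proof.
move=> dk ob; rewrite [in LHS](orthonormal_expand W dk ob) ip_suml.
by apply: eq_bigr => i _; rewrite ipZl (A_sym (b i)).
Qed.

(** A form that is diagonal in an orthonormal frame, with all diagonal entries
    but one equal, depends on the frame only through the exceptional vector. *)
Lemma diagonal_form (b : 'I_d -> 'rV[R]_d) (i0 : 'I_d) (la mu : R)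
    (q : 'rV[R]_d -> 'rV[R]_d -> R^o) v w :
  (forall i j, ip A (b i) (b j) = (i == j)%:R) -> bilin q ->
  (forall i j, q (b i) (b j) =
     if i != j then 0 else if i == i0 then la else mu) ->
  q v w = mu * ip A v w + (la - mu) * (ip A v (b i0) * ip A w (b i0)).
Proof.
move=> ob [ql qr] qb; rewrite (parseval v w (leqnn d) ob) mulr_sumr.
rewrite {1}(orthonormal_expand v (leqnn d) ob) (linear_sum_scale _ _ (ql w)).
have qbw i : q (b i) w = ip A w (b i) * (if i == i0 then la else mu).
  rewrite {1}(orthonormal_expand w (leqnn d) ob) (linear_sum_scale _ _ (qr _)).
  rewrite (bigD1 i) //= qb eqxx /= big1 ?addr0 // => j ji.
  by rewrite qb eq_sym ji scaler0.
rewrite (bigD1 i0) //= [in RHS](bigD1 i0) //= qbw eqxx.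
rewrite [in RHS]addrAC; congr (_ + _).
  by rewrite /GRing.scale /=; ring.
by apply: eq_bigr => i /negPf ii0; rewrite qbw ii0 /GRing.scale /=; ring.
Qed.

Lemma parseval_normal n k (b : 'I_n -> 'rV[R]_d) (c : 'I_k -> 'rV[R]_d) W W' :
  (d <= n + k)%N ->
  (forall i j, ip A (b i) (b j) = (i == j)%:R) ->
  (forall i j, ip A (c i) (c j) = (i == j)%:R) ->
  (forall i j, ip A (c i) (b j) = 0) ->
  (forall i, ip A W (b i) = 0) ->
  ip A W W' = \sum_i ip A W (c i) * ip A W' (c i).
Proof.
move=> dnk ob oc cb Wb.
pose bc (i : 'I_(n + k)) := match fintype.split i with inl i => b i | inr i => c i end.
have obc i j : ip A (bc i) (bc j) = (i == j)%:R.
  rewrite -(splitK i) -(splitK j) /bc !unsplitK.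
  case: (fintype.split i) (fintype.split j) => [i1|i1] [j1|j1] /=.
  - by rewrite ob (inj_eq (@lshift_inj _ _)).
  - by rewrite A_sym cb eq_lrshift.
  - by rewrite cb eq_rlshift.
  - by rewrite oc (inj_eq (@rshift_inj _ _)).
rewrite (parseval _ _ dnk obc) big_split_ord /= big1 ?add0r => [|i _].
  apply: eq_bigr => i _; rewrite /bc.
  by rewrite -[rshift n i]/(unsplit (inr i)) unsplitK.
rewrite /bc -[lshift k i]/(unsplit (inl i)) unsplitK.
by rewrite Wb mul0r.
Qed.

End OrthonormalFamilies.

(** * Curvature of a Sasakian space form *)

Section SasakianPoint.
Variables (R : realType) (d : nat) (N : manifold R d).
Variables (vphi : endofield N) (xi : vfield N) (eta : oneform N) (g : metric N).
Variables (c : R) (i : chart N) (p : 'rV[R]_d).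
Hypotheses (hS : sasakian vphi xi eta g) (ip_p : cimg i p).
Implicit Types v w x y : 'rV[R]_d.

(** The form ip(v, phi w) is d eta, hence alternating. *)
Lemma sasakian_skew v w :
  ip (g i p) v (w *m vphi i p) = - ip (g i p) w (v *m vphi i p).
Proof.
have [_ _ _ dE _] := hS ip_p; rewrite -!dE /ext_deriv !lie_cst.
have -> : ev (eta i p) (cst 0 p) = 0 by rewrite /ev mul0mx mxE.
by rewrite !subr0 -mulrN opprB.
Qed.

(** From phi^2 xi = 0 and the formula for phi^2 applied to phi xi, the vector
    phi xi is a multiple a xi, and then phi^2 xi = a^2 xi forces a = 0. *)
Lemma sasakian_phi_xi : xi i p *m vphi i p = 0.
Proof.
have [exi vv _ _ _] := hS ip_p.
have phi2 : xi i p *m vphi i p *m vphi i p = 0.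
  by rewrite vv exi scale1r addNr.
have := vv (xi i p *m vphi i p); rewrite phi2 mul0mx => /esym/eqP.
set a := ev _ _; rewrite addrC subr_eq0 eq_sym => /eqP aE.
have := phi2; rewrite aE -scalemxAl aE scalerA => /(congr1 (ev (eta i p))).
rewrite evZ exi mulr1 /ev mul0mx mxE => /eqP.
by rewrite mulf_eq0 orbb => /eqP ->; rewrite scale0r.
Qed.

Lemma sasakian_eta v : ev (eta i p) v = ip (g i p) v (xi i p).
Proof.
have [exi _ compat _ _] := hS ip_p.
have := compat v (xi i p); rewrite sasakian_phi_xi ip0r exi mulr1 => /eqP.
by rewrite eq_sym subr_eq0 => /eqP.
Qed.

Lemma space_form_sectional x y : sasakian_space_form vphi xi eta g c ->
  ip (g i p) x x = 1 -> ip (g i p) y y = 1 -> ip (g i p) x y = 0 ->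
  ev (eta i p) x = 0 ->
  ip (g i p) (curvature (levi_civita (g i)) p x y y) x =
  (c + 3) / 4 + (c - 1) / 4 *
    (3 * ip (g i p) (x *m vphi i p) y ^+ 2 - ev (eta i p) y ^+ 2).
Proof.
move=> [_ hR] x1 y1 xy ex; rewrite hR // /=.
have yx : ip (g i p) y x = 0 by rewrite (Defs.metric_sym g ip_p).
have yy : ip (g i p) y (y *m vphi i p) = 0.
  by have := sasakian_skew y y; lra.
have xphiy := sasakian_skew x y.
rewrite !(ipDl, ipZl, ipNl) x1 y1 xy yx ex yy.
rewrite xphiy (Defs.metric_sym g ip_p y (x *m _)) (Defs.metric_sym g ip_p (y *m _)) xphiy.
rewrite (Defs.metric_sym g ip_p y (x *m _)); ring.
Qed.

Lemma space_form_ricci n (b : 'I_n -> 'rV[R]_d) (i0 : 'I_n) :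
  sasakian_space_form vphi xi eta g c ->
  (forall k l, ip (g i p) (b k) (b l) = (k == l)%:R) ->
  ev (eta i p) (b i0) = 0 ->
  \sum_(j | j != i0)
    ip (g i p) (curvature (levi_civita (g i)) p (b i0) (b j) (b j)) (b i0) =
  (n%:R - 1) * ((c + 3) / 4) + (c - 1) / 4 *
    (3 * \sum_j ip (g i p) (b i0 *m vphi i p) (b j) ^+ 2
     - \sum_j ev (eta i p) (b j) ^+ 2).
Proof.
move=> hR ob e0.
have phi0 : ip (g i p) (b i0 *m vphi i p) (b i0) = 0.
  have := sasakian_skew (b i0) (b i0).
  by rewrite (Defs.metric_sym g ip_p (_ *m _)); lra.
have -> : \sum_j ip (g i p) (b i0 *m vphi i p) (b j) ^+ 2 =
    \sum_(j | j != i0) ip (g i p) (b i0 *m vphi i p) (b j) ^+ 2.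
  by rewrite (bigD1 i0) //= phi0 expr0n add0r.
have -> : \sum_j ev (eta i p) (b j) ^+ 2 =
    \sum_(j | j != i0) ev (eta i p) (b j) ^+ 2.
  by rewrite (bigD1 i0) //= e0 expr0n add0r.
have cardE : n%:R - 1 = \sum_(j | j != i0) (1 : R).
  have : \sum_(j : 'I_n) (1 : R) = n%:R by rewrite sumr_const card_ord.
  by rewrite (bigD1 i0) //= => <-; rewrite addrC addrK.
rewrite cardE mulr_suml [3 * _]mulr_sumr -sumrB mulr_sumr -big_split /=.
apply: eq_bigr => j ji0; rewrite mul1r.
by apply: space_form_sectional => //; rewrite ob ?eqxx // eq_sym (negPf ji0).
Qed.

End SasakianPoint.

(** * Gauss equation for the induced connection *)

(** The next identities are the algebra behind the geometric lemmas below, stated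
    for variables that stand for the derivatives occurring there. *)
Lemma connection_commutator (R : realType) (d : nat)
    (g : 'rV[R]_d -> 'rV[R]_d -> 'rV[R]_d)
    (e1 e2 e3 DB1 DB2 B1 B2 a1 a2 b1 b2 c1 c2 h1 h2 : 'rV[R]_d) :
  (forall x y y', g x (y + y') = g x y + g x y') ->
  DB1 = a1 + (b1 + g c1 e3 + g e2 h1) -> DB2 = a2 + (b2 + g c2 e3 + g e1 h2) ->
  a1 = a2 -> c1 = c2 -> B1 = h2 + g e2 e3 -> B2 = h1 + g e1 e3 ->
  DB1 + g e1 B1 - (DB2 + g e2 B2) =
  b1 - b2 + g e1 (g e2 e3) - g e2 (g e1 e3).
Proof.
move=> gD -> -> -> -> -> ->; rewrite !gD.
by apply/rowP => k; rewrite !mxE; ring.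
Qed.

Lemma regroup_gauss (R : comPzRingType) (a b K s1 s2 h1 h2 f1 f2 g1 g2 : R) :
  a - b = K + s1 * h2 - s2 * h1 ->
  a - (f1 * h1 - g1) - (b - (f2 * h2 - g2)) =
  K + s1 * h2 - s2 * h1 + g1 - g2 - f1 * h1 + f2 * h2.
Proof. by move=> <-; ring. Qed.

Lemma add_linear (R : pzRingType) (W : lmodType R) a (x x1 x2 y y1 y2 : W) :
  x = a *: x1 + x2 -> y = a *: y1 + y2 ->
  x + y = a *: (x1 + y1) + (x2 + y2).
Proof. by move=> -> ->; rewrite scalerDr addrACA. Qed.

Lemma swap_torsion (R : pzRingType) (W : lmodType R) (f1 f2 C1 C2 t x y : W) :
  f1 = f2 -> C1 = C2 -> t = x - y ->
  f1 + (C1 + x) = 1 *: t + (f2 + (C2 + y)).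
Proof.
move=> -> -> ->; rewrite scale1r !addrA addrC !addrA -(addrA (x - y)) -!addrA.
by rewrite (addrCA _ f2) (addrCA (- y)) (addrCA (-y)) addNr addr0 addrCA (addrC x).
Qed.

Lemma orthonormal_gauss (R : pzRingType) (K s1 s2 h1 h2 g1 g2 f1 f2 : R) :
  h1 = 1 -> h2 = 0 ->
  K + s1 * h2 - s2 * h1 + g1 - g2 - f1 * h1 + f2 * h2 =
  K - s2 + (g1 - g2) - f1.
Proof. by move=> -> ->; rewrite !mulr0 !mulr1 !addr0 addrA. Qed.

Lemma regroup_ricci (R : comPzRingType) (K Q s s' s0 f h p : R) :
  s' = s - s0 -> f = h - p ->
  K - s' + Q - f = K - s + s0 - h + p + Q.
Proof. by move=> -> ->; ring. Qed.

Section Immersion.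
Variables (R : realType) (n d : nat).
Variables (G : 'rV[R]_d -> 'M[R]_d) (phi : 'rV[R]_d -> 'cV[R]_d).
Variable (V : set 'rV[R]_d).
Hypotheses (oV : open V) (sG : smooth_on V G) (sphi : smooth_on V phi).
Hypothesis Gsym : forall p : 'rV[R]_d, V p ->
  forall v w, ip (G p) v w = ip (G p) w v.
Hypothesis Gpos : forall p : 'rV[R]_d, V p ->
  forall v, v != 0 -> 0 < ip (G p) v v.
Variables (F : 'rV[R]_n -> 'rV[R]_d) (U : set 'rV[R]_n).
Hypotheses (oU : open U) (sF : smooth_on U F).
Hypothesis FV : forall q : 'rV[R]_n, U q -> V (F q).
Hypothesis injF : forall q : 'rV[R]_n, U q -> injective ('d F q).
Implicit Types (q v w z x : 'rV[R]_n) (W : 'rV[R]_d).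

Let nearU q : U q -> \forall q' \near q, U q'.
Proof. by move=> Uq; exact: open_nbhs_nbhs. Qed.

Lemma ip_mxE k (A : 'M[R]_k) (v w : 'rV[R]_k) :
  ip A v w = \sum_i \sum_j v 0 i * w 0 j * A i j.
Proof.
rewrite /ip mxE exchange_big /=; apply: eq_bigr => j _.
rewrite !mxE mulr_suml; apply: eq_bigr => i _.
by rewrite mulrAC.
Qed.

Lemma diff_row_sum q v : 'd F q v = \sum_i v 0 i *: 'd F q (delta_mx 0 i).
Proof. by apply: linear_row_sum => a x y; rewrite linearP. Qed.

Lemma ip_induced q v w :
  ip (induced_metric G F q) v w = ip (G (F q)) ('d F q v) ('d F q w).
Proof.
rewrite ip_mxE (diff_row_sum q v) (diff_row_sum q w) ip_suml.
apply: eq_bigr => i _; rewrite ip_sumr; apply: eq_bigr => j _.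
by rewrite ipZl ipZr mxE mulrA.
Qed.

Lemma diff_eq0 q v : U q -> 'd F q v = 0 -> v = 0.
Proof. by move=> /injF inj dv0; apply: inj; rewrite dv0 linear0. Qed.

Lemma induced_unitmx q : U q -> induced_metric G F q \in unitmx.
Proof.
move=> Uq; apply: posdef_unitmx => v v0; rewrite ip_induced.
by apply: Gpos; [exact: FV|apply: contra_neq v0 => /(diff_eq0 Uq)].
Qed.

Lemma ip_tan_comp q W x : U q ->
  ip (induced_metric G F q) (tan_comp G F q W) x = ip (G (F q)) W ('d F q x).
Proof.
move=> Uq; pose l x : R^o := ip (G (F q)) W ('d F q x).
have ll : linear l by move=> a v w; rewrite /l linearP ipDr ipZr.
exact: (ip_row_invmx x (induced_unitmx Uq) ll).
Qed.

Lemma ip_tangential q W x : U q ->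
  ip (G (F q)) (tangential G F q W) ('d F q x) = ip (G (F q)) W ('d F q x).
Proof. by move=> Uq; rewrite -ip_induced ip_tan_comp. Qed.

Lemma ip_normal q W x : U q ->
  ip (G (F q)) (normal G F q W) ('d F q x) = 0.
Proof. by move=> Uq; rewrite ipBl ip_tangential // subrr. Qed.

Lemma ip_normal_normal q W W' : U q ->
  ip (G (F q)) (normal G F q W) (normal G F q W') =
  ip (G (F q)) (normal G F q W) W'.
Proof. by move=> Uq; rewrite {2}/normal ipBr ip_normal // subr0. Qed.

Lemma tan_comp_linear q : U q -> linear (tan_comp G F q).
Proof.
move=> Uq a W W'; apply: (ip_nondeg (induced_unitmx Uq)) => x.
by rewrite ipDl ipZl !ip_tan_comp // ipDl ipZl.
Qed.

Lemma normal_linear q : U q -> linear (normal G F q).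
Proof.
move=> Uq a W W'; rewrite /normal /tangential tan_comp_linear // linearP.
by rewrite scalerBr opprD addrACA.
Qed.

Lemma tan_comp_diff q v : U q -> tan_comp G F q ('d F q v) = v.
Proof.
move=> Uq; apply: (ip_nondeg (induced_unitmx Uq)) => x.
by rewrite ip_tan_comp // ip_induced.
Qed.

Lemma normal_diff q v : U q -> normal G F q ('d F q v) = 0.
Proof. by move=> Uq; rewrite /normal /tangential tan_comp_diff // subrr. Qed.

Lemma diff_differentiable q v : U q -> differentiable (fun q => 'd F q v) q.
Proof. by move=> Uq; exact: smooth_differentiable (smooth_diff v sF) Uq. Qed.

Lemma immersion_differentiable q : U q -> differentiable F q.
Proof. exact: smooth_differentiable. Qed.

Lemma metric_along_differentiable q : U q -> differentiable (fun q => G (F q)) q.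
Proof.
move=> Uq; apply: (differentiable_comp (immersion_differentiable Uq)).
exact: smooth_differentiable sG (FV Uq).
Qed.

(** By its definition tan_comp is obtained from metric coefficients and from the
    inverse of the induced metric, which is invertible by injectivity of dF. *)
Lemma tan_comp_differentiable (W : 'rV[R]_n -> 'rV[R]_d) q : U q ->
  differentiable W q -> differentiable (fun q => tan_comp G F q (W q)) q.
Proof.
move=> Uq dW; have dG := metric_along_differentiable Uq.
apply: differentiable_mulmx; last first.
  apply: differentiable_invmx; last first.
    by apply: filterS (nearU Uq) => q'; exact: induced_unitmx.
  apply/differentiable_mxP => i j.
  rewrite (_ : (fun q => _) = fun q =>
    ip (G (F q)) ('d F q (delta_mx 0 i)) ('d F q (delta_mx 0 j))).
    exact: (differentiable_ip dG (diff_differentiable _ Uq) (diff_differentiable _ Uq)).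
  by apply/funext => q'; rewrite mxE.
apply/differentiable_mxP => i j.
rewrite (_ : (fun q => _) = fun q => ip (G (F q)) (W q) ('d F q (delta_mx 0 j))).
  exact: (differentiable_ip dG dW (diff_differentiable _ Uq)).
by apply/funext => q'; rewrite mxE.
Qed.

Lemma tangential_differentiable (W : 'rV[R]_n -> 'rV[R]_d) q : U q ->
  differentiable W q -> differentiable (fun q => tangential G F q (W q)) q.
Proof.
move=> Uq dW; have dC := tan_comp_differentiable Uq dW.
rewrite (_ : (fun q => _) = fun q =>
  \sum_i (tan_comp G F q (W q)) 0 i *: 'd F q (delta_mx 0 i)).
  apply: differentiable_fsum => i; apply: differentiable_scalemx.
    exact: (differentiable_mxP _ _).1 dC 0 i.
  exact: diff_differentiable.
by apply/funext => q'; rewrite /tangential diff_row_sum.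
Qed.

Lemma normal_differentiable (W : 'rV[R]_n -> 'rV[R]_d) q : U q ->
  differentiable W q -> differentiable (fun q => normal G F q (W q)) q.
Proof.
by move=> Uq dW; apply: differentiableB => //; exact: tangential_differentiable.
Qed.

Lemma diff_diff_sym q v w : U q ->
  'D_v (fun q => 'd F q w) q = 'D_w (fun q => 'd F q v) q.
Proof.
move=> Uq; have dw := diff_differentiable w Uq; have dv := diff_differentiable v Uq.
apply: (etrans (deriveE v dw)); apply: (etrans _ (esym (deriveE w dv))).
exact: (diff_diffC w v oU Uq sF).
Qed.

Lemma second_diff_differentiable q v w : U q ->
  differentiable (fun q => 'D_v (fun q => 'd F q w) q) q.
Proof.
move=> Uq; apply: (@near_eq_differentiable _ _ _
    (fun q => 'd (fun q => 'd F q w) q v)).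
  apply: filterS (nearU Uq) => q' Uq'.
  by rewrite (deriveE v (diff_differentiable w Uq')).
exact: smooth_differentiable (smooth_diff v (smooth_diff w sF)) Uq.
Qed.

Lemma third_diff_sym q v w z : U q ->
  'D_v (fun q => 'D_w (fun q => 'd F q z) q) q =
  'D_w (fun q => 'D_v (fun q => 'd F q z) q) q.
Proof.
move=> Uq; pose f q := 'd F q z; have sf : smooth_on U f by exact: smooth_diff.
have E x y : 'D_x (fun q => 'D_y f q) q = 'd (fun q => 'd f q y) q x.
  have nf : \forall q' \near q, 'D_y f q' = 'd f q' y.
    apply: filterS (nearU Uq) => q' Uq'.
    exact: (deriveE y (smooth_differentiable sf Uq')).
  apply: (etrans (near_eq_derive x nf)); apply: deriveE.
  exact: smooth_differentiable (smooth_diff y sf) Uq.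
apply: (etrans (E v w)); apply: (etrans _ (esym (E w v))).
exact: (diff_diffC w v oU Uq sf).
Qed.

Section GaussEquation.
Variables (u : 'rV[R]_n) (Uu : U u).

Let Vu : V (F u) := FV Uu.
Let Gam := ssnm_coef G phi.
Let Gam_bilin (p : 'rV[R]_d) : V p -> bilin (Gam p).
Proof. exact: ssnm_bilin. Qed.
Let dGam (p a b : 'rV[R]_d) : V p ->
  differentiable (fun r : 'rV[R]_d => Gam r a b) p.
Proof. exact: (ssnm_differentiable oV). Qed.

Let B v w := ssnm_along G phi F (cst v) (cst w).

Let B_E v w q : B v w q = 'D_v (fun q => 'd F q w) q + Gam (F q) ('d F q v) ('d F q w).
Proof. by []. Qed.

Let dB v w q : U q -> differentiable (B v w) q.
Proof.
move=> Uq; apply: differentiableD; first exact: second_diff_differentiable.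
exact: (differentiable_along oV (FV Uq) Gam_bilin
  (fun a b => dGam a b (FV Uq)) (immersion_differentiable Uq)
  (diff_differentiable v Uq) (diff_differentiable w Uq)).
Qed.

Let derive_B v w z :
  'D_v (B w z) u = 'D_v (fun q => 'D_w (fun q => 'd F q z) q) u
  + ('D_('d F u v) (fun p => Gam p ('d F u w) ('d F u z)) (F u)
     + Gam (F u) ('D_v (fun q => 'd F q w) u) ('d F u z)
     + Gam (F u) ('d F u w) ('D_v (fun q => 'd F q z) u)).
Proof.
have dw := diff_differentiable w Uu; have dz := diff_differentiable z Uu.
have dF := immersion_differentiable Uu.
have dG a b : differentiable (fun p : 'rV[R]_d => Gam p a b) (F u) by exact: dGam.
have dA := differentiable_along oV Vu Gam_bilin dG dF dw dz.
have dD := second_diff_differentiable w z Uu.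
have := deriveD (diff_derivable dD : derivable _ _ v)
  (diff_derivable dA : derivable _ _ v).
move=> E; apply: (etrans E); congr (_ + _).
apply: (etrans (derive_along oV Vu Gam_bilin dG dF dw dz v)).
by rewrite (deriveE _ (dG _ _)).
Qed.

(** The commutator of ambient derivatives along F is the ambient curvature: the
    third derivatives of F cancel by symmetry. *)
Lemma ambient_curvature_along v w z :
  'D_v (B w z) u + Gam (F u) ('d F u v) (B w z u)
  - ('D_w (B v z) u + Gam (F u) ('d F u w) (B v z u)) =
  coef_curvature Gam (F u) ('d F u v) ('d F u w) ('d F u z).
Proof.
have [_ Gr] := Gam_bilin Vu.
have GD (x y y' : 'rV[R]_d) : Gam (F u) x (y + y') = Gam (F u) x y + Gam (F u) x y'.
  by have := Gr x 1 y y'; rewrite !scale1r.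
exact: (connection_commutator GD (derive_B v w z) (derive_B w v z)
  (third_diff_sym v w z Uu) (diff_diff_sym v w Uu) (B_E w z u) (B_E v z u)).
Qed.

Lemma derive_metric_along v :
  'D_v (fun q => G (F q)) u = 'D_('d F u v) G (F u).
Proof.
have dG := smooth_differentiable sG Vu; have dF := immersion_differentiable Uu.
apply: (etrans (deriveE v (metric_along_differentiable Uu))).
apply: (etrans _ (esym (deriveE _ dG))).
exact: (congr1 (fun f => f v) (diff_comp dF dG)).
Qed.

(** Differentiating the orthogonality of W to the image of dF: the tangential part
    of its derivative is dual to the second fundamental form, and the
    connection adds the multiple phi(W) of the differentiating vector. *)
Lemma weingarten (W : 'rV[R]_n -> 'rV[R]_d) v x : differentiable W u ->
  (forall q y, U q -> ip (G (F q)) (W q) ('d F q y) = 0) ->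
  ip (G (F u)) ('D_v W u + Gam (F u) ('d F u v) (W u)) ('d F u x) =
  ev (phi (F u)) (W u) * ip (G (F u)) ('d F u v) ('d F u x)
  - ip (G (F u)) (W u) (B v x u).
Proof.
move=> dW Wn.
have E0 : 'D_v (fun q => ip (G (F q)) (W q) ('d F q x)) u = 0.
  have nW : \forall q \near u, ip (G (F q)) (W q) ('d F q x) = cst 0 q.
    by apply: filterS (nearU Uu) => q Uq; exact: Wn.
  by apply: (etrans (near_eq_derive v nW)); rewrite derive_cst.
have := etrans (esym E0) (derive_ip v (metric_along_differentiable Uu) dW
  (diff_differentiable x Uu)).
have := christoffel_metric oV sG Gsym Gpos ('d F u v) (W u) ('d F u x) Vu.
rewrite derive_metric_along => ->.
rewrite /Gam /ssnm_coef B_E /Gam /ssnm_coef.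
move: ('D_v W u) ('D_v (fun q => 'd F q x) u) (christoffel G (F u)) => a b C E.
have := Wn u v Uu; move: E.
rewrite !(ipDl, ipDr, ipZl, ipZr) => E Wv; rewrite Wv mulr0 addr0.
by apply/eqP; rewrite -subr_eq0; apply/eqP; rewrite [RHS]E; ring.
Qed.

Let sff' w z q := normal G F q (B w z q).

Let dsff w z : differentiable (sff' w z) u.
Proof. exact: normal_differentiable (dB w z Uu). Qed.

(** The tangential field D_w z differs from the ambient derivative B w z by
    the normal field sigma(w, z), to which [weingarten] applies. *)
Lemma induced_conn2 v w z x :
  ip (induced_metric G F u)
    (induced_conn G phi F (cst v) (induced_conn G phi F (cst w) (cst z)) u) x =
  ip (G (F u)) ('D_v (B w z) u + Gam (F u) ('d F u v) (B w z u)) ('d F u x)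
  - (ev (phi (F u)) (sff G phi F u w z) * ip (G (F u)) ('d F u v) ('d F u x)
     - ip (G (F u)) (sff G phi F u w z) (sff G phi F u v x)).
Proof.
have dBu := dB w z Uu.
have dT := tangential_differentiable Uu dBu.
have DT : 'D_v (sff' w z) u =
    'D_v (B w z) u - 'D_v (fun q => tangential G F q (B w z q)) u.
  exact: deriveB (diff_derivable dBu) (diff_derivable dT).
have W := weingarten v x (dsff w z) (fun q y => ip_normal (B w z q) y).
have NN : ip (G (F u)) (sff G phi F u w z) (B v x u) =
    ip (G (F u)) (sff G phi F u w z) (sff G phi F u v x).
  by rewrite [RHS]ip_normal_normal.
rewrite -NN -[sff G phi F u w z]/(sff' w z u) -W.
apply: (etrans (ip_tan_comp _ _ Uu)).
rewrite -ipBl; congr (ip _ _ _).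
rewrite /ssnm_along.
apply: (@eq_trans _ _ ('D_v (fun q => tangential G F q (B w z q)) u
  + Gam (F u) ('d F u v) (tangential G F u (B w z u)))); first by [].
have -> : tangential G F u (B w z u) = B w z u - sff' w z u.
  by rewrite /sff' /normal opprB addrC subrK.
rewrite DT; have [_ Gr] := Gam_bilin Vu.
have -> : B w z u - sff' w z u = -1 *: sff' w z u + B w z u.
  by rewrite scaleN1r addrC.
rewrite (Gr _ (-1) (sff' w z u) (B w z u)).
move: ('D_v (B w z) u) ('D_v (fun q => tangential G F q (B w z q)) u) => a b.
move: (Gam (F u) ('d F u v)) (sff' w z u) (B w z u) => g1 W0 B0.
by apply/rowP => k; rewrite !mxE; ring.
Qed.

Lemma induced_conn0 z x :
  ip (induced_metric G F u) (induced_conn G phi F (cst 0) (cst z) u) x = 0.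
Proof.
apply: (etrans (ip_tan_comp _ _ Uu)); rewrite /ssnm_along derive0 add0r linear0.
have [Gl _] := Gam_bilin Vu.
have -> : ssnm_coef G phi (F u) 0 ('d F u (cst z u)) = 0.
  rewrite -[ssnm_coef G phi]/Gam (linear_row_sum 0 (Gl _)) big1 // => i _.
  by rewrite mxE scale0r.
by rewrite ip0l.
Qed.

Theorem gauss_equation v w z x :
  ip (induced_metric G F u) (curvature (induced_conn G phi F) u v w z) x =
  ip (G (F u)) (curvature (levi_civita G) (F u) ('d F u v) ('d F u w) ('d F u z))
     ('d F u x)
  + s_tensor G phi (F u) ('d F u v) ('d F u z)
    * ip (G (F u)) ('d F u w) ('d F u x)
  - s_tensor G phi (F u) ('d F u w) ('d F u z)
    * ip (G (F u)) ('d F u v) ('d F u x)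
  + ip (G (F u)) (sff G phi F u w z) (sff G phi F u v x)
  - ip (G (F u)) (sff G phi F u v z) (sff G phi F u w x)
  - ev (phi (F u)) (sff G phi F u w z) * ip (G (F u)) ('d F u v) ('d F u x)
  + ev (phi (F u)) (sff G phi F u v z) * ip (G (F u)) ('d F u w) ('d F u x).
Proof.
rewrite [in LHS]/curvature lie_cst [LHS]ipBl [X in X - _ = _]ipBl.
rewrite induced_conn0 subr0 !induced_conn2.
set a := ip _ ('D_v _ _ + _) _; set b := ip _ ('D_w _ _ + _) _.
have ab : a - b =
  ip (G (F u)) (coef_curvature Gam (F u) ('d F u v) ('d F u w) ('d F u z)) ('d F u x).
  by rewrite -ambient_curvature_along ipBl.
rewrite (ssnm_curvature oV sG sphi Gsym Gpos _ _ _ Vu) ipBl ipDl !ipZl in ab.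
exact: (regroup_gauss _ _ _ _ ab).
Qed.

Lemma ip_sff_diff v w x : ip (G (F u)) (sff G phi F u v w) ('d F u x) = 0.
Proof. exact: ip_normal. Qed.

Lemma sff_linear w : linear (fun v => sff G phi F u v w).
Proof.
move=> a v v'; have dw := diff_differentiable w Uu.
have D1 := derive_linear a v v' dw.
have [Gl _] := Gam_bilin Vu.
have BE : B (a *: v + v') w u = a *: B v w u + B v' w u.
  have G1 : Gam (F u) ('d F u (a *: v + v')) ('d F u w) =
      a *: Gam (F u) ('d F u v) ('d F u w) + Gam (F u) ('d F u v') ('d F u w).
    by rewrite linearP; exact: Gl.
  exact: (add_linear D1 G1).
apply: (etrans (congr1 (normal G F u) BE)); exact: normal_linear.
Qed.

(** The torsion phi(Y) X - phi(X) Y is tangent, hence invisible to sigma. *)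
Lemma sff_sym v w : sff G phi F u v w = sff G phi F u w v.
Proof.
set t := ev (phi (F u)) ('d F u w) *: v - ev (phi (F u)) ('d F u v) *: w.
have tE : 'd F u t = ev (phi (F u)) ('d F u w) *: 'd F u v
    - ev (phi (F u)) ('d F u v) *: 'd F u w.
  by rewrite /t linearB !linearZ.
have BE : B v w u = 1 *: 'd F u t + B w v u.
  exact: (swap_torsion (diff_diff_sym v w Uu)
    (christoffel_sym oV sG Gsym Gpos ('d F u v) ('d F u w) Vu) tE).
apply: (etrans (congr1 (normal G F u) BE)).
by apply: (etrans (normal_linear Uu 1 _ _)); rewrite normal_diff // scaler0 add0r.
Qed.

Variables (e : 'I_n -> 'rV[R]_n) (nu : 'I_(d - n) -> 'rV[R]_d) (i0 : 'I_n).
Hypotheses (he : tangent_frame G F u e) (hnu : normal_frame G F u nu).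
Hypothesis i00 : i0 = 0%N :> nat.

Let ipE i j : ip (G (F u)) ('d F u (e i)) ('d F u (e j)) = (i == j)%:R.
Proof. by rewrite -ip_induced he. Qed.

Lemma ip_normal_sum N W : (forall v, ip (G (F u)) N ('d F u v) = 0) ->
  ip (G (F u)) N W = \sum_al ip (G (F u)) N (nu al) * ip (G (F u)) W (nu al).
Proof.
move=> Nn; have [onu nue] := hnu.
apply: (parseval_normal (Gsym Vu) (b := fun i => 'd F u (e i))) => //.
by rewrite -leq_subLR.
Qed.

(** Only the terms of the Gauss equation without the factor ip(e_j, e_i0) = 0
    survive; the products of sigma are expanded in the normal frame. *)
Lemma ricci_expand : ricci G phi F u (e i0) e =
  \sum_(j | j != i0) ip (G (F u)) (curvature (levi_civita G) (F u)
      ('d F u (e i0)) ('d F u (e j)) ('d F u (e j))) ('d F u (e i0))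
  - \sum_(j | j != i0) s_tensor G phi (F u) ('d F u (e j)) ('d F u (e j))
  + \sum_al ricci_form i0 (fun i j => sff_comp G phi F u nu al (e i) (e j))
  - \sum_(j | j != i0) ev (phi (F u)) (sff G phi F u (e j) (e j)).
Proof.
have -> : ricci G phi F u (e i0) e = \sum_(j | j != i0)
    ip (induced_metric G F u)
      (curvature (induced_conn G phi F) u (e i0) (e j) (e j)) (e i0).
  by apply: eq_bigl => j; rewrite lt0n -i00.
rewrite /ricci_form exchange_big -sumrB -big_split -sumrB /=.
apply: eq_bigr => j ji0.
have h1 : ip (G (F u)) ('d F u (e i0)) ('d F u (e i0)) = 1 by rewrite ipE eqxx.
have h2 : ip (G (F u)) ('d F u (e j)) ('d F u (e i0)) = 0.
  by rewrite ipE (negPf ji0).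
apply: (etrans (gauss_equation (e i0) (e j) (e j) (e i0))).
apply: (etrans (orthonormal_gauss _ _ _ _ _ _ _ h1 h2)); congr (_ + _ - _).
rewrite sumrB; congr (_ - _).
  apply: (etrans (ip_normal_sum _ (ip_sff_diff (e j) (e j)))).
  by apply: eq_bigr => al _; exact: mulrC.
apply: (etrans (ip_normal_sum _ (ip_sff_diff (e i0) (e j)))).
by apply: eq_bigr => al _; rewrite (sff_sym (e j) (e i0)); exact: esym (expr2 _).
Qed.

Lemma sqnorm_tangential W :
  ip (G (F u)) (tangential G F u W) (tangential G F u W) =
  \sum_j ip (G (F u)) W ('d F u (e j)) ^+ 2.
Proof.
have symI v w : ip (induced_metric G F u) v w = ip (induced_metric G F u) w v.
  by rewrite !ip_induced; exact: Gsym.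
rewrite -ip_induced (parseval symI _ _ (leqnn n) he).
by apply: eq_bigr => j _; rewrite ip_tan_comp // -expr2.
Qed.

Lemma ip_sharp_normal N : (forall v, ip (G (F u)) N ('d F u v) = 0) ->
  ip (G (F u)) (normal G F u (sharp (G (F u)) (phi (F u)))) N =
  ev (phi (F u)) N.
Proof.
move=> Nn; rewrite /normal ipBl [X in _ - X]Gsym // Nn subr0.
rewrite /ip /sharp mulmxKV; last exact: (metric_unitmx Gpos).
by rewrite -trmx_mul mxE.
Qed.

Lemma mean_curvature_normal v :
  ip (G (F u)) (mean_curvature G phi F u e) ('d F u v) = 0.
Proof.
rewrite /mean_curvature ipZl ip_suml big1 ?mulr0 // => i _.
exact: ip_sff_diff.
Qed.

Lemma mean_curvature_comp al :
  ip (G (F u)) (mean_curvature G phi F u e) (nu al) =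
  trace_mean (fun i j => sff_comp G phi F u nu al (e i) (e j)).
Proof. by rewrite /mean_curvature ipZl ip_suml. Qed.

Lemma sqnorm_mean_curvature :
  ip (G (F u)) (mean_curvature G phi F u e) (mean_curvature G phi F u e) =
  \sum_al trace_mean (fun i j => sff_comp G phi F u nu al (e i) (e j)) ^+ 2.
Proof.
apply: (etrans (ip_normal_sum _ mean_curvature_normal)).
by apply: eq_bigr => al _; rewrite mean_curvature_comp -expr2.
Qed.

Let Pperp := normal G F u (sharp (G (F u)) (phi (F u))).

Lemma sum_phi_sff :
  \sum_(j | j != i0) ev (phi (F u)) (sff G phi F u (e j) (e j)) =
  n%:R * ip (G (F u)) Pperp (mean_curvature G phi F u e)
  - ip (G (F u)) Pperp (sff G phi F u (e i0) (e i0)).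
Proof.
have phiE j : ev (phi (F u)) (sff G phi F u (e j) (e j)) =
    ip (G (F u)) Pperp (sff G phi F u (e j) (e j)).
  by rewrite (ip_sharp_normal (ip_sff_diff (e j) (e j))).
have nn : n%:R != 0 :> R by rewrite pnatr_eq0 -lt0n (leq_ltn_trans _ (ltn_ord i0)).
rewrite (eq_bigr _ (fun j _ => phiE j)) /mean_curvature ipZr ip_sumr mulVKf //.
by rewrite (bigD1 i0 (P := xpredT)) //= addrC addrK.
Qed.

Lemma ricci_decomposition : ricci G phi F u (e i0) e =
  \sum_(j | j != i0) ip (G (F u)) (curvature (levi_civita G) (F u)
      ('d F u (e i0)) ('d F u (e j)) ('d F u (e j))) ('d F u (e i0))
  - \sum_j s_tensor G phi (F u) ('d F u (e j)) ('d F u (e j))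
  + s_tensor G phi (F u) ('d F u (e i0)) ('d F u (e i0))
  - n%:R * ip (G (F u)) Pperp (mean_curvature G phi F u e)
  + ip (G (F u)) Pperp (sff G phi F u (e i0) (e i0))
  + \sum_al ricci_form i0 (fun i j => sff_comp G phi F u nu al (e i) (e j)).
Proof.
apply: (etrans ricci_expand).
have sE : \sum_(j | j != i0) s_tensor G phi (F u) ('d F u (e j)) ('d F u (e j)) =
    \sum_j s_tensor G phi (F u) ('d F u (e j)) ('d F u (e j))
    - s_tensor G phi (F u) ('d F u (e i0)) ('d F u (e i0)).
  by rewrite [in RHS](bigD1 i0) //= addrC addrK.
exact: (regroup_ricci _ _ sE sum_phi_sff).
Qed.

Lemma sff_comp_bilin al :
  bilin (fun v w => sff_comp G phi F u nu al v w : R^o).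
Proof.
have lin w : linear (fun v => sff_comp G phi F u nu al v w : R^o).
  move=> a v v'; rewrite /sff_comp (sff_linear w a v v') ipDl ipZl.
  by [].
have sym v w : sff_comp G phi F u nu al v w = sff_comp G phi F u nu al w v.
  by rewrite /sff_comp (sff_sym v w).
split; first exact: lin.
move=> v a w w'; apply: (etrans (sym v _)); apply: (etrans (lin v a w w')).
by rewrite (sym w v) (sym w' v).
Qed.

Lemma sff_comp_diagonal al (e' : 'I_n -> 'rV[R]_n) la mu :
  tangent_frame G F u e' -> e' i0 = e i0 ->
  (forall i j, sff_comp G phi F u nu al (e' i) (e' j) =
     if i != j then 0 else if i == i0 then la else mu) ->
  forall i j, sff_comp G phi F u nu al (e i) (e j) =
     if i != j then 0 else if i == i0 then la else mu.
Proof.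
move=> he' e'0 sE i j.
have symI v w : ip (induced_metric G F u) v w = ip (induced_metric G F u) w v.
  by rewrite !ip_induced; exact: Gsym.
apply: (etrans (diagonal_form symI (e i) (e j) he' (sff_comp_bilin al) sE)).
rewrite e'0 !he; case: eqVneq => [<-|ij] /=; last first.
  rewrite mulr0 add0r; case: eqVneq => [ii0|_]; last by rewrite mul0r mulr0.
  by rewrite -ii0 eq_sym (negPf ij) mulr0 mulr0.
by case: (i == i0); rewrite ?(mulr0, mulr1, mulr1n, mulr0n) ?addr0 // addrC subrK.
Qed.

End GaussEquation.
End Immersion.

(** * The Ricci estimate *)

Section Charts.
Variables (R : realType) (n d : nat) (M : manifold R n) (N : manifold R d).
Variables (f : M -> N) (a : chart M) (b : chart N).
Hypothesis cf : continuous f.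

Lemma open_locrep_dom : open (locrep_dom f a b).
Proof.
rewrite openE => q [x [ax bx] <-].
have oA : open (cdom a `&` f @^-1` cdom b).
  by apply: openI; [exact: cdom_open|apply: open_comp => //; exact: cdom_open].
have nc : \forall q' \near cmap a x, (cdom a `&` f @^-1` cdom b) (cinv a q').
  apply: (cinv_continuous ax); rewrite (cmapK ax).
  exact: open_nbhs_nbhs.
have ni : \forall q' \near cmap a x, (cmap a @` cdom a) q'.
  by apply: open_nbhs_nbhs; split; [exact: cimg_open|exists x].
apply: filterS2 nc ni => q' + [x' ax' x'q]; rewrite -x'q cmapK // => h.
by exists x'.
Qed.

Lemma locrep_cimg q : locrep_dom f a b q -> cimg b (locrep f a b q).
Proof. by move=> [x [ax bx] <-]; exists (f x) => //; rewrite /locrep /= cmapK. Qed.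

End Charts.

Theorem theorem4p12 (R : realType) (m n : nat) (c : R)
    (N : manifold R (2 * m).+1)
    (vphi : endofield N) (xi : vfield N) (eta : oneform N) (g : metric N)
    (phi : oneform N) (M : manifold R n) (f : M -> N)
    (hn : (2 <= n)%N)
    (hN : sasakian_space_form vphi xi eta g c)
    (hf : immersion f)
    (hxi : tangent_to f xi)
    (x : M) (a : chart M) (b : chart N) (hxa : cdom a x) (hxb : cdom b (f x)) :
  let u : 'rV[R]_n := cmap a x in
  let F : 'rV[R]_n -> 'rV[R]_(2 * m).+1 := locrep f a b in
  let y : 'rV[R]_(2 * m).+1 := F u in
  let gt v w : R := ip (g b y) v w in
  let s v w : R := s_tensor (g b) (phi b) y ('d F u v) ('d F u w) in
  let sigma v w : 'rV[R]_(2 * m).+1 := sff (g b) (phi b) F u v w in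
  forall (X : 'rV[R]_n) (e : 'I_n -> 'rV[R]_n)
    (nu : 'I_((2 * m).+1 - n) -> 'rV[R]_(2 * m).+1),
  gt ('d F u X) ('d F u X) = 1 ->
  gt ('d F u X) (xi b y) = 0 ->
  tangent_frame (g b) F u e -> starts_with X e ->
  normal_frame (g b) F u nu ->
  let sg al v w : R := sff_comp (g b) (phi b) F u nu al v w in
  let H : 'rV[R]_(2 * m).+1 := mean_curvature (g b) (phi b) F u e in
  let Hal al : R := n%:R^-1 * \sum_(i < n) sg al (e i) (e i) in
  let sqsg al : R := \sum_(i < n) \sum_(j < n) sg al (e i) (e j) ^+ 2 in
  let sqsigma : R := \sum_al sqsg al in
  let normH : R := Num.sqrt (gt H H) in
  let lam : R := \sum_(i < n) s (e i) (e i) in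
  let Pperp := normal (g b) F u (sharp (g b y) (phi b y)) in
  let TX := tangential (g b) F u ('d F u X *m vphi b y) in
  let Ric : R := ricci (g b) (phi b) F u X e in
  let bound : R :=
    (n%:R - 1) * ((c + 3) / 4) + (c - 1) / 4 * (3 * gt TX TX - 1)
    - lam + s X X - n%:R * gt Pperp H + gt Pperp (sigma X X)
    + calH n normH sqsigma in
  let rad al : R :=
    Num.sqrt ((n%:R * sqsg al - n%:R ^+ 2 * Hal al ^+ 2) / (n%:R - 1)) in
  let lamal al (eps : R) : R := Hal al - (n%:R - 1) / n%:R * eps * rad al in
  let mual al (eps : R) : R := Hal al + n%:R^-1 * eps * rad al in
  let D al : R :=
    Num.sqrt (n%:R * (sqsg al - n%:R * Hal al ^+ 2) / (n%:R - 1)) in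
  bound <= Ric /\
  ((3 <= n)%N ->
   (Ric = bound <->
    (exists e' : 'I_n -> 'rV[R]_n,
       [/\ tangent_frame (g b) F u e', starts_with X e' &
        forall al, exists eps : R,
          (if Hal al != 0 then eps = Num.sg (Hal al)
           else eps = 1 \/ eps = -1) /\
          forall i j : 'I_n, sg al (e' i) (e' j) =
            if i != j then 0
            else if i == 0%N :> nat then lamal al eps else mual al eps]) /\
    (H != 0 -> exists2 rho : R, 0 <= rho &
       forall al, D al = rho * `|Hal al|))).
Proof.
move=> u F y gt s sigma X e nu X1 Xxi he hX hnu sg H Hal sqsg sqsigma normH lam.
move=> Pperp TX Ric bound rad lamal mual D.
have [cf imm] := hf; have [sF injF] := imm a b.
have Uu : locrep_dom f a b u by exists x.
have oU : open (locrep_dom f a b) by exact: open_locrep_dom.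
have FV q (Uq : locrep_dom f a b q) := locrep_cimg Uq.
have Vy : cimg b y := FV u Uu.
have oV : open (cimg b) := @cimg_open _ _ N b.
have sG := metric_smooth g b; have sphi := oneform_smooth phi b.
have Gsym p (Vp : cimg b p) := Defs.metric_sym g Vp.
have Gpos p (Vp : cimg b p) := Defs.metric_pos g Vp.
have n0 : (0 < n)%N := ltnW hn.
pose i0 : 'I_n := Ordinal n0.
have eX : e i0 = X by exact: hX.
have ipE i j : gt ('d F u (e i)) ('d F u (e j)) = (i == j)%:R.
  by rewrite -he (ip_induced (g b)).
have [hS hR] := hN.
have ambient : \sum_(j | j != i0) gt (curvature (levi_civita (g b)) y
      ('d F u (e i0)) ('d F u (e j)) ('d F u (e j))) ('d F u (e i0)) =
    (n%:R - 1) * ((c + 3) / 4) + (c - 1) / 4 * (3 * gt TX TX - 1).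
  have e0 : ev (eta b y) ('d F u (e i0)) = 0 by rewrite (sasakian_eta hS Vy) eX.
  apply: (etrans (space_form_ricci hS Vy hN ipE e0)); congr (_ + _ * (3 * _ - _)).
    rewrite eX; apply: esym.
    exact: (sqnorm_tangential Gsym Gpos FV injF Uu he).
  (* xi is a unit vector tangent to the submanifold and dual to eta, so the
     squares of the components of eta in the frame add up to 1. *)
  have [v vxi] := hxi a b u Uu.
  have [exi _ _ _ _] := hS b y Vy.
  transitivity (gt (xi b y) (xi b y)); last first.
    exact: etrans (esym (sasakian_eta hS Vy _)) exi.
  have -> : xi b y = tangential (g b) F u (xi b y).
    by rewrite -vxi /tangential (tan_comp_diff Gpos FV injF).
  apply: esym; apply: (etrans (sqnorm_tangential Gsym Gpos FV injF Uu he _)).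
  apply: eq_bigr => j _; congr (_ ^+ 2).
  exact: esym (etrans (sasakian_eta hS Vy _) (Gsym _ Vy _ _)).
pose aa al i j := sg al (e i) (e j).
pose Q := \sum_al ricci_form i0 (aa al).
pose bound0 := (n%:R - 1) * ((c + 3) / 4) + (c - 1) / 4 * (3 * gt TX TX - 1)
  - lam + s X X - n%:R * gt Pperp H + gt Pperp (sigma X X).
have RicE : Ric = bound0 + Q.
  have := ricci_decomposition oV sG sphi Gsym Gpos oU sF FV injF Uu he hnu
    (erefl : i0 = 0%N :> nat).
  move=> /(fun E => etrans E (congr1 (fun K => K - lam + s (e i0) (e i0)
    - n%:R * gt Pperp H + gt Pperp (sigma (e i0) (e i0)) + Q) ambient)).
  by rewrite eX.
have aa_sym al i j : aa al i j = aa al j i.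
  rewrite /aa /sg /sff_comp.
  by rewrite (sff_sym _ oV sG Gsym Gpos oU sF FV injF Uu (e i) (e j)).
have normHE : normH = Num.sqrt (\sum_al trace_mean (aa al) ^+ 2).
  exact: (congr1 Num.sqrt (sqnorm_mean_curvature _ Gsym Gpos FV injF Uu he hnu)).
have H0 : (H != 0) = (normH != 0).
  congr negb; rewrite sqrtr_eq0; apply/eqP/idP => [->|]; first by rewrite /gt ip0l.
  by apply: contraTeq => /(Gpos _ Vy); rewrite -ltNge.
have radE al : rad al = spread (aa al).
  by congr Num.sqrt; rewrite expr2 -mulrA -mulrBr.
split.
  rewrite RicE -[bound]/(bound0 + calH n normH sqsigma) lerD2l normHE.
  exact: (calH_le i0 hn aa_sym).
move=> n3; have eqE : (Ric = bound) <-> (Q = calH n normH sqsigma).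
  rewrite RicE -[bound]/(bound0 + calH n normH sqsigma).
  by split=> [/addrI|->].
have := calH_eq i0 hn aa_sym n3; rewrite -normHE -/Q => calHE.
apply: (iff_trans eqE); apply: (iff_trans calHE); rewrite H0.
have ordE (i : 'I_n) : (i == 0%N :> nat) = (i == i0) by [].
split=> -[ext prop]; split=> //.
  exists e; split=> // al; have [eps [epsE aE]] := ext al.
  exists eps; split=> // i j; rewrite ordE /lamal /mual radE; exact: aE.
move=> al; have [e' [he' hX' ext']] := ext.
have [eps [epsE aE]] := ext' al.
exists eps; split=> // i j.
have e'0 : e' i0 = e i0 by rewrite eX; exact: hX'.
have aE' k l : sff_comp (g b) (phi b) F u nu al (e' k) (e' l) =
    if k != l then 0 else if k == i0 then lamal al eps else mual al eps.
  exact: aE.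
apply: (etrans (sff_comp_diagonal oV sG Gsym Gpos oU sF FV injF Uu he he' e'0 aE' i j)).
by rewrite /lamal /mual radE.
Qed.
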